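(* Let $m,n\geq 1$ and let $X',X''\in lT^n_m$ be two complementary pairs of trees with levels. Then $$\varpi(X')=\varpi(X'')\quad\text{(equality in the biarity }(n,m)\text{ component of the free PROP } \mathsf F(\Xi))$$ if and only if $$\pi(X')=\pi(X'')\quad\text{(equality in } zT^n_m).$$ Consequently, the image of $\varpi: lT^n_m\to\mathsf F(\Xi)$ is isomorphic (i.e. in bijection via $\varpi(X)\leftrightarrow\pi(X)$) to $zT^n_m$.
   Context: **Trees.** A planar directed (rooted) tree is a planar tree with a specified leg called the root; the remaining legs are the leaves. All vertices have at least three adjacent edges. The exceptional tree has one edge and no vertices; it is the unique tree with one leaf. An up-rooted tree has its root at the top and leaves at the bottom, edges oriented towards the root; a down-rooted tree has its root at the bottom and leaves at the top, edges oriented away from the root. So all edges point upwards. $\mathrm{Vert}(T)$ is the set of vertices. For distinct $v',v''\in\mathrm{Vert}(T)$ write $v'\prec v''$ if there is an oriented edge path from $v''$ to $v'$ (so $v'$ is above $v''$). The root vertex is the vertex adjacent to the root. **Complementary pairs with levels.** $lT^n_m$ is the set of triples $(U,D,\ell)$ with $U$ an up-rooted planar tree with $m$ leaves, $D$ a down-rooted planar tree with $n$ leaves and $\ell:\mathrm{Vert}(U)\sqcup\mathrm{Vert}(D)\to\{1,\dots,h\}$ a surjection (some $h\ge 0$) such that $v'\prec v''$ (both in $U$ or both in $D$) implies $\ell(v')<\ell(v'')$. Levels are numbered from the top down, so ''$v'$ is above $v''$'' means $\ell(v')<\ell(v'')$. **Complementary pairs with zones.** Consider triples $(U,D,z)$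 with $U$ an up-rooted planar tree with $m$ leaves, $D$ a down-rooted planar tree with $n$ leaves and $z:\mathrm{Vert}(U)\sqcup\mathrm{Vert}(D)\to\{1,\dots,l\}$ a surjection such that $v'\prec v''$ implies $z(v')\le z(v'')$. An $i\in\{1,\dots,l\}$ is a barrier if $z^{-1}(i)$ contains both a vertex of $U$ and a vertex of $D$; otherwise it is a zone, called an up-zone if $z^{-1}(i)\subset\mathrm{Vert}(U)$ and a down-zone if $z^{-1}(i)\subset\mathrm{Vert}(D)$. The map $z$ is a zone function if (i) distinct vertices of the same tree with the same value $i$, where $i$ is a barrier, are unrelated by $\prec$, and (ii) there is no $i$ such that $i,i+1$ are both up-zones or both down-zones. $zT^n_m$ is the set of all such triples $(U,D,z)$ with $z$ a zone function. **Canonical projection $\pi:lT^n_m\to zT^n_m$.** For $(U,D,\ell)\in lT^n_m$ call a level $i$ an up-level (resp. down-level) if $\ell^{-1}(i)\subset\mathrm{Vert}(U)$ (resp. $\subset\mathrm{Vert}(D)$). Let $p:\{1,\dots,h\}\to\{1,\dots,l\}$ be the quotient of ordinals identifying adjacent up-levels and adjacent down-levels. Put $\pi(U,D,\ell):=(U,D,p\circ\ell)$. **PROPs and fractions.** A PROP in sets is a collection of sets $\mathsf P(n,m)$, $m,n\ge1$ (operations with $m$ inputs and $n$ outputs, of biarity $(n,m)$), with compatible $\Sigma_n$- and $\Sigma_m$-actions, vertical composition $\circ:\mathsf P(n,u)\times\mathsf P(u,m)\to\mathsf P(n,m)$, horizontal composition $\boxtimes:\mathsf P(n_1,m_1)\times\mathsf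 P(n_2,m_2)\to\mathsf P(n_1+n_2,m_1+m_2)$ and unit $e\in\mathsf P(1,1)$, satisfying the usual axioms. $\mathsf F(\Xi)$ is the free PROP in sets generated by $\Xi=\{\xi^n_m\mid m,n\ge1,\ (m,n)\ne(1,1)\}$, with $\xi^n_m$ of biarity $(n,m)$ ($m$ inputs, $n$ outputs). For $A_1,\dots,A_l$ with $A_j\in\mathsf P(k,a_j)$ and $B_1,\dots,B_k$ with $B_i\in\mathsf P(b_i,l)$ the fraction is $$\frac{B_1\cdots B_k}{A_1\cdots A_l}:=(B_1\boxtimes\cdots\boxtimes B_k)\circ\sigma\circ(A_1\boxtimes\cdots\boxtimes A_l)\in\mathsf P(b_1+\cdots+b_k,a_1+\cdots+a_l),$$ where $\sigma\in\Sigma_{kl}$ is $\sigma(i)=l(i-1-(s-1)k)+s$ for $(s-1)k<i\le sk$; i.e. the $t$-th output of $A_s$ is connected to the $s$-th input of $B_t$. **Restriction.** For $X=(U,D,\ell)\in lT^n_m$ and subtrees $\overline U\subset U$, $\overline D\subset D$ with $\overline m$, $\overline n$ leaves, $r_{\overline U,\overline D}(X)=(\overline U,\overline D,\overline\ell)\in lT^{\overline n}_{\overline m}$, where $\overline\ell$ is the restriction of $\ell$ to $\mathrm{Vert}(\overline U)\sqcup\mathrm{Vert}(\overline D)$ with its image renumbered order-preservingly as $\{1,\dots,\overline h\}$. **The map $\varpi:lT^n_m\to\mathsf F(\Xi)(n,m)$.** For a single tree: $\varpi(\text{exceptional tree})=e$. If an up-rooted tree $U$ has root vertex with $a\ge2$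 inputs to which the (possibly exceptional) up-rooted trees $U_1,\dots,U_a$ (left to right) are attached, then $\varpi(U)=\xi^1_a\circ(\varpi(U_1)\boxtimes\cdots\boxtimes\varpi(U_a))$. Dually, if a down-rooted tree $D$ has root vertex with $b\ge 2$ outputs to which $D_1,\dots,D_b$ are attached, $\varpi(D)=(\varpi(D_1)\boxtimes\cdots\boxtimes\varpi(D_b))\circ\xi^b_1$. For $X=(U,D,\ell)$: if $D$ is exceptional, $\varpi(X)=\varpi(U)$; if $U$ is exceptional, $\varpi(X)=\varpi(D)$. Otherwise $\varpi(X)$ is defined by induction on the number of vertices of $D$: *Case 1*: the root vertex of $D$ is above the root vertex of $U$. Then $\varpi(X)=\varpi(D)\circ\varpi(U)$. *Case 2*: the root vertices of $D$ and $U$ are on the same level. Decompose $U$ into its root vertex with $a$ inputs and attached trees $U_1,\dots,U_a$, and $D$ into its root vertex with $b$ outputs and attached trees $D_1,\dots,D_b$. Then $\varpi(X)=(\varpi(D_1)\boxtimes\cdots\boxtimes\varpi(D_b))\circ\xi^b_a\circ(\varpi(U_1)\boxtimes\cdots\boxtimes\varpi(U_a))$. *Case 3*: the root vertex of $D$ is below the root vertex of $U$. Let $T\subset U$ be the maximal up-rooted subtree, containing the root, formed by all vertices of $U$ strictly above the level of the root vertex of $D$; let $a$ be its number of leaves and $U_1,\dots,U_a$ the (possibly exceptional) up-rooted subtrees of $U$ attached to these leaves, left to right, containing the remaining vertices of $U$. Decompose $D$ into its root corolla $c^b_1$ (one vertex, $b$ leaves) and the trees $D_1,\dots,D_b$ attached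 to the $b$ outputs of its root vertex. Put $X_i=r_{U_i,c^b_1}(X)$ for $1\le i\le a$ and $Y_j=r_{T,D_j}(X)$ for $1\le j\le b$. Then $$\varpi(X)=\frac{\varpi(Y_1)\cdots\varpi(Y_b)}{\varpi(X_1)\cdots\varpi(X_a)}.$$ *)

(* Defs.v *)
From HB Require Import structures.
From mathcomp Require Import all_boot all_fingroup.
From mathcomp Require Import boolp classical_sets functions.

Set Implicit Arguments.
Unset Strict Implicit.
Unset Printing Implicit Defensive.

(* A planar rooted tree T together with a function Vert(T) -> A: every vertex
   carries its value, and the subtrees attached to it are listed from left to
   right.  [Leaf] is the exceptional tree.  The same type serves for up-rooted
   and for down-rooted trees. *)
Inductive ptree (A : Type) : Type :=
| Leaf
| Node of A & seq (ptree A).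
Arguments Leaf {A}.

Fixpoint planar A (T : ptree A) : bool :=
  if T is Node _ s then (1 < size s) && all (@planar A) s else true.

Fixpoint leaves A (T : ptree A) : nat :=
  if T is Node _ s then sumn (map (@leaves A) s) else 1.

(* The values of the function, one for each vertex. *)
Fixpoint labels A (T : ptree A) : seq A :=
  if T is Node a s then a :: flatten (map (@labels A) s) else [::].

Definition nverts A (T : ptree A) : nat := size (labels T).

Fixpoint tmap A B (f : A -> B) (T : ptree A) : ptree B :=
  if T is Node a s then Node (f a) (map (tmap f) s) else Leaf.

(* [desc r T]: r holds between the value at v and the value at w for all
   vertices v, w such that w is a proper descendant of v, i.e. such that v lies
   on the path from w to the root and v <> w.  Since all edges point upwards,
   this means v < w (v is above w) if T is up-rooted, and w < v if T is
   down-rooted, for the relation "there is an oriented edge path". *)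
Fixpoint desc A (r : rel A) (T : ptree A) : bool :=
  if T is Node a s then all (fun t => all (r a) (labels t) && desc r t) s
  else true.

(* An up-rooted tree U and a down-rooted tree D with a function on
   Vert(U) + Vert(D); the first component is U. *)
Definition tpair : Type := (ptree nat * ptree nat)%type.

Definition plabels (X : tpair) : seq nat := labels X.1 ++ labels X.2.

(* The number h of levels (resp. l of zones and barriers): 0 without vertices. *)
Definition height (X : tpair) : nat := foldr maxn 0 (plabels X).

(* The labelling is a surjection onto {1, ..., height X}. *)
Definition onto_interval (X : tpair) : bool :=
  all (leq 1) (plabels X) && all (mem (plabels X)) (iota 1 (height X)).

(* For a value i that is attained: its preimage is contained in Vert(U), resp.
   in Vert(D). *)
Definition in_up (X : tpair) (i : nat) : bool := i \notin labels X.2.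
Definition in_down (X : tpair) (i : nat) : bool := i \notin labels X.1.

(* Meaningful for 1 <= i < height X: i and i+1 are both up-levels (up-zones)
   or both down-levels (down-zones). *)
Definition same_kind (X : tpair) (i : nat) : bool :=
  (in_up X i && in_up X i.+1) || (in_down X i && in_down X i.+1).

Definition barrier (X : tpair) (i : nat) : bool :=
  (i \in labels X.1) && (i \in labels X.2).

Definition trees_ok (n m : nat) (X : tpair) : bool :=
  [&& planar X.1, planar X.2, leaves X.1 == m & leaves X.2 == n].

Definition is_level (n m : nat) (X : tpair) : bool :=
  [&& trees_ok n m X, onto_interval X, desc ltn X.1 & desc gtn X.2].

(* The lines involving [barrier] say that two vertices of one tree whose common
   value is a barrier are unrelated. *)
Definition is_zone (n m : nat) (X : tpair) : bool :=
  [&& trees_ok n m X, onto_interval X,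
      desc leq X.1, desc geq X.2,
      desc (fun i j => ~~ ((i == j) && barrier X i)) X.1,
      desc (fun i j => ~~ ((i == j) && barrier X i)) X.2
    & all (fun i => ~~ same_kind X i) (iota 1 (height X).-1)].

(* m is the number of leaves of U, and n that of D. *)
Definition lT (n m : nat) : Type := {X : tpair | is_level n m X}.
Definition zT (n m : nat) : Type := {X : tpair | is_zone n m X}.

(* The quotient p : {1, ..., h} -> {1, ..., l} of ordinals: p i.+1 = p i if
   same_kind X i, and p i.+1 = (p i).+1 otherwise. *)
Definition merge (X : tpair) (i : nat) : nat :=
  (count (fun j => ~~ same_kind X j) (iota 1 i.-1)).+1.

Definition proj (X : tpair) : tpair :=
  (tmap (merge X) X.1, tmap (merge X) X.2).

Section TreeTheory.
Variables (A B : Type).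
Implicit Types (T : ptree A) (r : rel A).

Lemma ptree_ind' (P : ptree A -> Prop) :
  P Leaf ->
  (forall a s, (forall i, i < size s -> P (nth Leaf s i)) -> P (Node a s)) ->
  forall T, P T.
Proof.
move=> PL PN; fix IH 1; case=> [|a s]; first exact: PL.
apply: PN; elim: s => [|t s IHs] i.
  by clear IH; rewrite ltn0.
case: i => [_|i lti]; [exact: IH t | exact: IHs i lti].
Qed.

Lemma all_nth_ptree (p : pred (ptree A)) s :
  reflect (forall i, i < size s -> p (nth Leaf s i)) (all p s).
Proof. exact: all_nthP. Qed.

Lemma labels_tmap (f : A -> B) T : labels (tmap f T) = map f (labels T).
Proof.
elim/ptree_ind': T => //= a s IH; congr cons.
rewrite map_flatten -!map_comp; congr flatten.
apply: (@eq_from_nth _ [::]); rewrite ?size_map // => i lti.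
by rewrite !(nth_map Leaf) //= IH.
Qed.

Lemma nverts_tmap (f : A -> B) T : nverts (tmap f T) = nverts T.
Proof. by rewrite /nverts labels_tmap size_map. Qed.

Lemma planar_tmap (f : A -> B) T : planar (tmap f T) = planar T.
Proof.
elim/ptree_ind': T => //= a s IH; rewrite size_map all_map; congr andb.
by apply/all_nth_ptree/all_nth_ptree => h i lti; have := h i lti; rewrite /= IH.
Qed.

Lemma leaves_tmap (f : A -> B) T : leaves (tmap f T) = leaves T.
Proof.
elim/ptree_ind': T => //= a s IH; rewrite -map_comp; congr sumn.
apply: (@eq_from_nth _ 0); rewrite ?size_map // => i lti.
by rewrite !(nth_map Leaf) //= IH.
Qed.

Lemma desc_tmap (f : A -> B) (r : rel B) T :
  desc r (tmap f T) = desc (fun x y => r (f x) (f y)) T.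
Proof.
elim/ptree_ind': T => //= a s IH; rewrite all_map.
by apply/all_nth_ptree/all_nth_ptree => h i lti; have := h i lti;
   rewrite /= labels_tmap all_map IH.
Qed.

End TreeTheory.

Lemma desc_sub (A : eqType) (r r' : rel A) (T : ptree A) :
  {in labels T &, forall x y, r x y -> r' x y} -> desc r T -> desc r' T.
Proof.
elim/ptree_ind': T => //= a s IH h /all_nth_ptree hs.
apply/all_nth_ptree => i lti; have /andP[h1 h2] := hs i lti.
have sub x : x \in labels (nth Leaf s i) ->
    x \in a :: flatten (map (@labels A) s).
  move=> xi; rewrite inE; apply/orP; right; apply/flattenP.
  by exists (labels (nth Leaf s i)); rewrite // -(nth_map _ [::]) // mem_nth ?size_map.
apply/andP; split.
  apply/allP => x xi; apply: h; rewrite ?mem_head ?sub //.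
  by move/allP: h1; apply.
by apply: IH h2 => // x y xi yi; apply: h; apply: sub.
Qed.

Section Projection.
Variables (n m : nat) (X : tpair).

Lemma mergeS i : 0 < i -> merge X i.+1 = merge X i + ~~ same_kind X i.
Proof.
case: i => // i _; rewrite /merge -!pred_Sn -{1}[i.+1]addn1 iotaD count_cat.
by rewrite /= add1n addn0 addSn.
Qed.

Lemma merge_mono : {homo merge X : i j / i <= j}.
Proof.
move=> i j ij; rewrite /merge ltnS.
have -> : j.-1 = i.-1 + (j.-1 - i.-1) by rewrite subnKC // -!subn1 leq_sub2r.
by rewrite iotaD count_cat leq_addr.
Qed.

Lemma le_height i : i \in plabels X -> i <= height X.
Proof.
rewrite /height; elim: (plabels X) => //= a s IH; rewrite inE leq_max.
by case/orP => [/eqP->|/IH->]; rewrite ?leqnn ?orbT.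
Qed.

End Projection.

Lemma height_mem (X : tpair) : 0 < height X -> height X \in plabels X.
Proof.
rewrite /height; elim: (plabels X) => //= a s IH.
case: (leqP a (foldr maxn 0 s)) => _; last by rewrite inE eqxx.
by rewrite inE => /IH->; rewrite orbT.
Qed.

Lemma onto_memE (X : tpair) : onto_interval X ->
  forall i, (i \in plabels X) = (0 < i <= height X).
Proof.
case/andP => /allP h1 /allP h2 i; apply/idP/idP => [hi|hi].
  by rewrite le_height // andbT; apply: h1.
by apply: h2; rewrite mem_iota add1n ltnS.
Qed.

Lemma plabels_proj (X : tpair) : plabels (proj X) = map (merge X) (plabels X).
Proof. by rewrite /plabels /= !labels_tmap map_cat. Qed.

Lemma height_proj (X : tpair) : 0 < height X ->
  height (proj X) = merge X (height X).
Proof.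
move=> h0; apply/eqP; rewrite eqn_leq; apply/andP; split.
  have h1 : 0 < height (proj X).
    have := height_mem h0; rewrite /height plabels_proj.
    by case: (plabels X) => //= a s _; rewrite leq_max.
  have := height_mem h1; rewrite plabels_proj => /mapP[i hi ->].
  exact/merge_mono/le_height.
by apply: le_height; rewrite plabels_proj map_f // height_mem.
Qed.

(* Every value of the step function merge is attained last at some level. *)
Lemma merge_last (X : tpair) h i : 0 < i <= merge X h -> 0 < h ->
  exists j, [/\ 0 < j <= h, merge X j = i & (i < merge X h) ->
     [/\ j < h, merge X j.+1 = i.+1 & ~~ same_kind X j]].
Proof.
elim: h => // h IH; case: h IH => [_|h IH] hi _.
  have -> : i = 1.
    by case/andP: hi => i0 hi; apply/eqP; rewrite eqn_leq i0 andbT.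
  by exists 1.
have eM := mergeS X (isT : 0 < h.+1); case/andP: hi => i0.
rewrite leq_eqVlt => /orP[/eqP e|lti].
  by exists h.+2; split=> //; rewrite ?leqnn // e ltnn.
move: (lti); rewrite eM; case: (boolP (same_kind X h.+1)) => /= hk.
  rewrite addn0 => lti'; have hi' : 0 < i <= merge X h.+1 by rewrite i0 ltnW.
  have [j [h1 h2 h3]] := IH hi' isT.
  exists j; split=> //; first by case/andP: h1 => -> /leqW.
  by move=> _; have [h4 h5 h6] := h3 lti'; split=> //; apply: leqW.
rewrite addn1 ltnS => lei; have hi' : 0 < i <= merge X h.+1 by rewrite i0.
have [j [h1 h2 h3]] := IH hi' isT.
move: lei; rewrite leq_eqVlt => /orP[/eqP e|lti']; last first.
  exists j; split=> //; first by case/andP: h1 => -> /leqW.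
  by move=> _; have [h4 h5 h6] := h3 lti'; split=> //; apply: leqW.
exists h.+1; split=> //; first by rewrite leqnSn.
by move=> _; split=> //; rewrite eM hk addn1 e.
Qed.

Lemma merge_barrier (X : tpair) i j : onto_interval X -> i <= j ->
  i \in plabels X -> j \in plabels X ->
  merge X i = merge X j -> barrier (proj X) (merge X i) -> i = j.
Proof.
move=> oX; rewrite leq_eqVlt => /orP[/eqP//|ltij] hi hj e.
(* between i and j all consecutive levels have the same kind *)
pose c := merge X i.
have sk k l : 0 < k -> k < l -> merge X k = merge X l -> same_kind X k.
  move=> k0 kl ekl; apply/negPn/negP => nk.
  have := merge_mono X kl; rewrite mergeS // nk -ekl addn1.
  by rewrite ltnn.
have kind (S : tpair -> nat -> bool) k l : 
    (forall k, same_kind X k -> k \in plabels X -> k.+1 \in plabels X ->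
       S X k = S X k.+1) ->
    0 < k -> k <= l -> l <= height X -> merge X k = merge X l -> S X k = S X l.
  move=> hS k0; elim: l => [|l IH]; first by rewrite leqn0 => /eqP->.
  rewrite leq_eqVlt => /orP[/eqP->//|]; rewrite ltnS => kl lh ekl.
  have ekl' : merge X k = merge X l.
    apply/eqP; rewrite eqn_leq merge_mono //= ekl merge_mono //.
  have l0 : 0 < l by apply: leq_trans kl.
  rewrite IH //; last by apply: ltnW.
  apply: hS; rewrite ?onto_memE ?l0 //=; last by apply: ltnW.
  by apply: (sk l l.+1); rewrite // -ekl -ekl'.
have kup k : same_kind X k -> k \in plabels X -> k.+1 \in plabels X ->
     in_up X k = in_up X k.+1.
  rewrite /same_kind /in_up /in_down /plabels !mem_cat.
  by do 4 case: (_ \in _).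
have kdn k : same_kind X k -> k \in plabels X -> k.+1 \in plabels X ->
     in_down X k = in_down X k.+1.
  rewrite /same_kind /in_up /in_down /plabels !mem_cat.
  by do 4 case: (_ \in _).
have pos k : k \in plabels X -> 0 < k <= height X by rewrite onto_memE.
have cst (S : tpair -> nat -> bool) k : 
    (forall k, same_kind X k -> k \in plabels X -> k.+1 \in plabels X ->
       S X k = S X k.+1) -> k \in plabels X -> merge X k = c -> S X k = S X i.
  move=> hS hk ek; have /andP[k0 kh] := pos _ hk; have /andP[i0 ih] := pos _ hi.
  case/orP: (leq_total k i) => le; first exact: (kind S).
  by apply/esym; apply: (kind S).
move=> /andP[]; rewrite !labels_tmap => /mapP[k hk ek] /mapP[l hl el].
have := cst in_down k kdn; rewrite mem_cat hk => /(_ isT (esym ek)).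
rewrite /in_down hk /= => ndi.
have := cst in_up l kup; rewrite mem_cat hl orbT => /(_ isT (esym el)).
rewrite /in_up hl /= => nui.
have /andP[i0 ih] := pos _ hi.
have := sk i j i0 ltij e.
by rewrite /same_kind /in_up /in_down -ndi -nui.
Qed.

Lemma proj_zone n m (X : tpair) : is_level n m X -> is_zone n m (proj X).
Proof.
case/and4P => hX oX dU dD; apply/and5P; split.
- by move: hX; rewrite /trees_ok /= !planar_tmap !leaves_tmap.
- apply/andP; split; first by rewrite plabels_proj all_map; apply/allP.
  apply/allP => i; rewrite mem_iota add1n ltnS plabels_proj => hi.
  case: (posnP (height X)) => h0.
    have e : plabels X = [::].
      case e: (plabels X) => [//|a s].
      have := onto_memE oX a; rewrite e mem_head h0 leqn0.
      by case: a {e}.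
    by move: hi; rewrite /height plabels_proj e /=; case: i.
  rewrite height_proj // in hi; have [j [h1 h2 _]] := merge_last hi h0.
  by apply/mapP; exists j => //; rewrite onto_memE.
- by rewrite desc_tmap; apply: desc_sub dU => x y _ _ /ltnW /(merge_mono X).
- by rewrite desc_tmap; apply: desc_sub dD => x y _ _ /ltnW /(merge_mono X).
apply/and3P; split.
- rewrite desc_tmap; apply: desc_sub dU => x y hx hy /= xy.
  apply/negP => /andP[/eqP e b]; move: (xy).
  rewrite (merge_barrier oX (ltnW xy) _ _ e b) ?ltnn // /plabels mem_cat ?hx ?hy //.
- rewrite desc_tmap; apply: desc_sub dD => x y hx hy /= xy.
  apply/negP => /andP[/eqP e b]; move: (xy); rewrite e in b.
  rewrite (merge_barrier oX (ltnW xy) _ _ (esym e) b) ?ltnn //.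
    by rewrite /plabels mem_cat hy orbT.
  by rewrite /plabels mem_cat hx orbT.
apply/allP => i; rewrite mem_iota add1n.
case: (posnP (height X)) => h0.
  have e : plabels X = [::].
    case e: (plabels X) => [//|a s].
    have := onto_memE oX a; rewrite e mem_head h0 leqn0.
    by case: a {e}.
  by rewrite /height plabels_proj e /=; case: i.
rewrite height_proj // => /andP[i0 hi].
have lti : i < merge X (height X) by move: hi; rewrite prednK.
have hi' : 0 < i <= merge X (height X) by rewrite i0 ltnW.
have [j [h1 h2 /(_ lti) [_ h4 h5]]] := merge_last hi' h0; apply: contra h5.
case/andP: h1 => j0 jh.
rewrite /same_kind /in_up /in_down /= !labels_tmap.
case/orP => /andP[/negP a /negP b]; apply/orP; [left|right].
  apply/andP; split; apply/negP => h; first by apply: a; rewrite -h2 map_f.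
  by apply: b; rewrite -h4 map_f.
apply/andP; split; apply/negP => h; first by apply: a; rewrite -h2 map_f.
by apply: b; rewrite -h4 map_f.
Qed.

Definition zproj n m (X : lT n m) : zT n m :=
  exist _ (proj (sval X)) (proj_zone (svalP X)).

(* [s : 'S_n] stands for the bijection i |-> s i of {0, ..., n-1}.  Beware that
   (s * t) i = t (s i) in MathComp. *)

Section Permutations.

Definition block_fun n1 n2 (s1 : 'S_n1) (s2 : 'S_n2) (i : 'I_(n1 + n2)) :
    'I_(n1 + n2) :=
  match fintype.split i with
  | inl j => lshift n2 (s1 j)
  | inr j => rshift n1 (s2 j)
  end.

Definition swap_fun n1 n2 (i : 'I_(n1 + n2)) : 'I_(n1 + n2) :=
  cast_ord (addnC n2 n1)
    (match fintype.split i with inl j => rshift n2 j | inr j => lshift n1 j end).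

Lemma frac_subproof l k (i : 'I_(l * k)) : (i %% k) * l + i %/ k < l * k.
Proof.
have k0 : 0 < k by case: k i => // -[i]; rewrite muln0.
have hq : i %/ k < l by rewrite ltn_divLR.
apply: (@leq_trans ((i %% k).+1 * l)); first by rewrite mulSnr ltn_add2l.
by rewrite [X in _ <= X]mulnC leq_mul2r ltn_pmod ?orbT.
Qed.

Definition frac_fun l k (i : 'I_(l * k)) : 'I_(l * k) :=
  Ordinal (frac_subproof i).

Lemma block_inj n1 n2 (s1 : 'S_n1) (s2 : 'S_n2) : injective (block_fun s1 s2).
Proof.
move=> i j; rewrite /block_fun -{2}(splitK i) -{2}(splitK j).
case: (fintype.split i) => a; case: (fintype.split j) => b /= /eqP;
  rewrite ?eq_lshift ?eq_rshift ?eq_lrshift ?eq_rlshift // => /eqP/perm_inj->//.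
Qed.

Lemma swap_inj n1 n2 : injective (@swap_fun n1 n2).
Proof.
move=> i j; rewrite /swap_fun -{2}(splitK i) -{2}(splitK j) => /cast_ord_inj.
case: (fintype.split i) => a; case: (fintype.split j) => b /= /eqP;
  rewrite ?eq_lshift ?eq_rshift ?eq_lrshift ?eq_rlshift // => /eqP->//.
Qed.

Lemma frac_inj l k : injective (@frac_fun l k).
Proof.
move=> i j /(congr1 val) /= e; apply: val_inj => /=.
have k0 : 0 < k by case: k i {j e} => // -[i]; rewrite muln0.
have lt (x : 'I_(l * k)) : x %/ k < l by rewrite ltn_divLR.
have l0 : 0 < l := leq_ltn_trans (leq0n _) (lt i).
have eq : i %/ k = j %/ k.
  by have := congr1 (modn^~ l) e; rewrite !modnMDl !modn_small.
have er : i %% k = j %% k.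
  have := congr1 (divn^~ l) e; rewrite !divnMDl //.
  by rewrite (divn_small (lt i)) (divn_small (lt j)) !addn0.
by rewrite (divn_eq i k) (divn_eq j k) eq er.
Qed.

(* s1 on the first n1 elements and s2 on the last n2 elements. *)
Definition block_perm n1 n2 (s1 : 'S_n1) (s2 : 'S_n2) : 'S_(n1 + n2) :=
  perm (@block_inj _ _ s1 s2).

(* Moves the first n1 elements behind the last n2 elements. *)
Definition swap_perm n1 n2 : 'S_(n1 + n2) := perm (@swap_inj n1 n2).

(* The permutation of the fraction; counting from 0, it sends s * k + t to
   t * l + s for s < l and t < k. *)
Definition frac_perm l k : 'S_(l * k) := perm (@frac_inj l k).

End Permutations.

Definition cast_op (P : nat -> nat -> Type) n n' m m' (en : n = n')
    (em : m = m') (x : P n m) : P n' m' :=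
  ecast i (P i m') en (ecast j (P n j) em x).

(* The n-fold horizontal power (n > 0) of the unit. *)
Fixpoint units_of (P : nat -> nat -> Type) (e : P 1 1)
    (b : forall n1 m1 n2 m2, P n1 m1 -> P n2 m2 -> P (n1 + n2) (m1 + m2))
    (n : nat) : P n.+1 n.+1 :=
  if n is k.+1 then b _ _ _ _ e (units_of e b k) else e.

(* [op n m] is the set of operations with n outputs and m inputs, n, m >= 1;
   there are no other operations by [op_gt0].  [actl s x] moves the i-th output
   of x to position s i, and the i-th input of [actr x s] is the (s i)-th input
   of x. *)
Record PROP := MkPROP {
  op :> nat -> nat -> Type;
  op_gt0 : forall n m, op n m -> (0 < n) && (0 < m);
  op1 : op 1 1;
  vcomp : forall n u m, op n u -> op u m -> op n m;
  hcomp : forall n1 m1 n2 m2, op n1 m1 -> op n2 m2 -> op (n1 + n2) (m1 + m2);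
  actl : forall n m, 'S_n -> op n m -> op n m;
  actr : forall n m, op n m -> 'S_m -> op n m;
  actl1 : forall n m (x : op n m), actl 1 x = x;
  actlM : forall n m (s t : 'S_n) (x : op n m),
    actl (s * t) x = actl t (actl s x);
  actr1 : forall n m (x : op n m), actr x 1 = x;
  actrM : forall n m (s t : 'S_m) (x : op n m),
    actr x (s * t) = actr (actr x t) s;
  actlr : forall n m (s : 'S_n) (t : 'S_m) (x : op n m),
    actr (actl s x) t = actl s (actr x t);
  vcompA : forall n u v m (x : op n u) (y : op u v) (z : op v m),
    vcomp (vcomp x y) z = vcomp x (vcomp y z);
  vcomp1l : forall n m (x : op n.+1 m), vcomp (units_of op1 hcomp n) x = x;
  vcomp1r : forall n m (x : op n m.+1), vcomp x (units_of op1 hcomp m) = x;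
  vcomp_actl : forall n u m (s : 'S_n) (x : op n u) (y : op u m),
    vcomp (actl s x) y = actl s (vcomp x y);
  vcomp_actr : forall n u m (s : 'S_m) (x : op n u) (y : op u m),
    vcomp x (actr y s) = actr (vcomp x y) s;
  vcomp_actlr : forall n u m (s : 'S_u) (x : op n u) (y : op u m),
    vcomp (actr x s) y = vcomp x (actl s y);
  hcompA : forall n1 m1 n2 m2 n3 m3
      (x : op n1 m1) (y : op n2 m2) (z : op n3 m3),
    cast_op (addnA n1 n2 n3) (addnA m1 m2 m3) (hcomp x (hcomp y z)) =
    hcomp (hcomp x y) z;
  hcompC : forall n1 m1 n2 m2 (x : op n1 m1) (y : op n2 m2),
    actl (swap_perm n1 n2) (hcomp x y) =
    actr (cast_op (addnC n2 n1) (addnC m2 m1) (hcomp y x)) (swap_perm m1 m2);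
  hcomp_actl : forall n1 m1 n2 m2 (s : 'S_n1) (t : 'S_n2)
      (x : op n1 m1) (y : op n2 m2),
    hcomp (actl s x) (actl t y) = actl (block_perm s t) (hcomp x y);
  hcomp_actr : forall n1 m1 n2 m2 (s : 'S_m1) (t : 'S_m2)
      (x : op n1 m1) (y : op n2 m2),
    hcomp (actr x s) (actr y t) = actr (hcomp x y) (block_perm s t);
  interchange : forall n1 u1 m1 n2 u2 m2
      (x1 : op n1 u1) (y1 : op u1 m1) (x2 : op n2 u2) (y2 : op u2 m2),
    vcomp (hcomp x1 x2) (hcomp y1 y2) = hcomp (vcomp x1 y1) (vcomp x2 y2)
}.
Arguments op1 : clear implicits.

Record is_morphism (P Q : PROP) (f : forall n m, P n m -> Q n m) : Prop := {
  morph_unit : f _ _ (op1 P) = op1 Q;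
  morph_vcomp : forall n u m (x : P n u) (y : P u m),
    f _ _ (vcomp x y) = vcomp (f _ _ x) (f _ _ y);
  morph_hcomp : forall n1 m1 n2 m2 (x : P n1 m1) (y : P n2 m2),
    f _ _ (hcomp x y) = hcomp (f _ _ x) (f _ _ y);
  morph_actl : forall n m (s : 'S_n) (x : P n m),
    f _ _ (actl s x) = actl s (f _ _ x);
  morph_actr : forall n m (s : 'S_m) (x : P n m),
    f _ _ (actr x s) = actr (f _ _ x) s
}.

(* There is one generator of biarity (n, m) if [is_gen n m], and none
   otherwise. *)
Definition is_gen (n m : nat) : bool :=
  [&& 0 < n, 0 < m & (n, m) != (1, 1)].

(* The free PROP is built as the quotient of the well-typed expressions in the
   operations of a PROP by the congruence generated by the axioms of a PROP;
   its universal property is [free_prop_universal] below. *)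
Inductive expr : Type :=
| EUnit
| EGen (n m : nat)
| EComp (x y : expr)
| EBox (x y : expr)
| EActl n (s : 'S_n) (x : expr)
| EActr (x : expr) m (s : 'S_m).

Fixpoint outs (t : expr) : nat :=
  match t with
  | EUnit => 1
  | EGen n _ => n
  | EComp x _ => outs x
  | EBox x y => outs x + outs y
  | EActl n _ _ => n
  | EActr x _ _ => outs x
  end.

Fixpoint inps (t : expr) : nat :=
  match t with
  | EUnit => 1
  | EGen _ m => m
  | EComp _ y => inps y
  | EBox x y => inps x + inps y
  | EActl _ _ x => inps x
  | EActr _ m _ => m
  end.

Fixpoint wt (t : expr) : bool :=
  match t with
  | EUnit => true
  | EGen n m => is_gen n m
  | EComp x y => [&& wt x, wt y & outs y == inps x]
  | EBox x y => wt x && wt y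
  | EActl n _ x => wt x && (outs x == n)
  | EActr x m _ => wt x && (inps x == m)
  end.

Definition has_biarity (n m : nat) (t : expr) : bool :=
  [&& wt t, outs t == n & inps t == m].

Fixpoint eunits (n : nat) : expr :=
  if n is k.+1 then EBox EUnit (eunits k) else EUnit.

Inductive prop_axiom : expr -> expr -> Prop :=
| ax_actl1 n x : prop_axiom (EActl (1 : 'S_n) x) x
| ax_actlM n (s t : 'S_n) x :
    prop_axiom (EActl (s * t)%g x) (EActl t (EActl s x))
| ax_actr1 m x : prop_axiom (EActr x (1 : 'S_m)) x
| ax_actrM m (s t : 'S_m) x :
    prop_axiom (EActr x (s * t)%g) (EActr (EActr x t) s)
| ax_actlr n m (s : 'S_n) (t : 'S_m) x :
    prop_axiom (EActr (EActl s x) t) (EActl s (EActr x t))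
| ax_vcompA x y z : prop_axiom (EComp (EComp x y) z) (EComp x (EComp y z))
| ax_vcomp1l n x : prop_axiom (EComp (eunits n) x) x
| ax_vcomp1r n x : prop_axiom (EComp x (eunits n)) x
| ax_vcomp_actl n (s : 'S_n) x y :
    prop_axiom (EComp (EActl s x) y) (EActl s (EComp x y))
| ax_vcomp_actr m (s : 'S_m) x y :
    prop_axiom (EComp x (EActr y s)) (EActr (EComp x y) s)
| ax_vcomp_actlr u (s : 'S_u) x y :
    prop_axiom (EComp (EActr x s) y) (EComp x (EActl s y))
| ax_hcompA x y z : prop_axiom (EBox x (EBox y z)) (EBox (EBox x y) z)
| ax_hcompC x y :
    prop_axiom (EActl (swap_perm (outs x) (outs y)) (EBox x y))
               (EActr (EBox y x) (swap_perm (inps x) (inps y)))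
| ax_hcomp_actl n1 n2 (s : 'S_n1) (t : 'S_n2) x y :
    prop_axiom (EBox (EActl s x) (EActl t y))
               (EActl (block_perm s t) (EBox x y))
| ax_hcomp_actr m1 m2 (s : 'S_m1) (t : 'S_m2) x y :
    prop_axiom (EBox (EActr x s) (EActr y t))
               (EActr (EBox x y) (block_perm s t))
| ax_interchange x1 y1 x2 y2 :
    prop_axiom (EComp (EBox x1 x2) (EBox y1 y2))
               (EBox (EComp x1 y1) (EComp x2 y2)).

(* An instance of an axiom may be used only if both of its sides are
   well-typed. *)
Inductive peq : expr -> expr -> Prop :=
| peq_axiom x y of prop_axiom x y & wt x & wt y : peq x y
| peq_refl x of wt x : peq x x
| peq_sym x y of peq x y : peq y x
| peq_trans x y z of peq x y & peq y z : peq x z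
| peq_comp x x' y y' of peq x x' & peq y y' & outs y = inps x :
    peq (EComp x y) (EComp x' y')
| peq_box x x' y y' of peq x x' & peq y y' : peq (EBox x y) (EBox x' y')
| peq_actl n (s : 'S_n) x x' of peq x x' & outs x = n :
    peq (EActl s x) (EActl s x')
| peq_actr m (s : 'S_m) x x' of peq x x' & inps x = m :
    peq (EActr x s) (EActr x' s).

Lemma units_biarity n : has_biarity n.+1 n.+1 (eunits n).
Proof. by elim: n. Qed.

Lemma wt_gt0 t : wt t -> (0 < outs t) && (0 < inps t).
Proof.
elim: t => //= [n m|x IHx y IHy|x IHx y IHy|n s x IHx|x IHx m s].
- by case/and3P => -> ->.
- by case/and3P => /IHx/andP[-> _] /IHy/andP[_ ->].
- by case/andP => /IHx/andP[h1 h2] /IHy _; rewrite !addn_gt0 h1 h2.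
- by case/andP => /IHx/andP[h1 h2] /eqP<-; rewrite h1.
- by case/andP => /IHx/andP[h1 h2] /eqP<-; rewrite h1.
Qed.

Lemma peq_wt x y : peq x y ->
  [/\ wt x, wt y, outs x = outs y & inps x = inps y].
Proof.
have U n := units_biarity n.
elim=> {x y} [x y a|||||||].
- case: x y / a => /=.
  + by move=> n x /andP[h /eqP e] _; split=> //; rewrite h e eqxx.
  + by move=> n s t x -> ->.
  + by move=> n x /andP[h /eqP e] _; split=> //; rewrite h e eqxx.
  + by move=> n s t x -> ->.
  + by move=> n m s t x -> ->.
  + by move=> x y z -> ->.
  + move=> n x h1 h2; rewrite h1 h2; have /and3P[_ /eqP e1 /eqP e2] := U n.
    case/and3P: h1 => _ _ /eqP e; split=> //.
    by rewrite e e1 e2.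
  + move=> n x h1 h2; rewrite h1 h2; have /and3P[_ /eqP e1 /eqP e2] := U n.
    case/and3P: h1 => _ _ /eqP e; split=> //.
    by rewrite -e e1 e2.
  + by move=> n s x y -> ->.
  + by move=> n s x y -> ->.
  + by move=> n s x y -> ->.
  + by move=> x y z -> ->; split=> //; rewrite addnA.
  + by move=> x y -> ->; split=> //; rewrite addnC.
  + by move=> n1 n2 s t x y -> ->.
  + by move=> n1 n2 s t x y -> ->.
  + by move=> x1 y1 x2 y2 -> ->.
- by [].
- by move=> x y _ [].
- by move=> x y z _ [? ? -> ->] _ [].
- move=> x x' y y' _ [h1 h2 e1 e2] _ [h3 h4 e3 e4] e /=.
  by rewrite h1 h2 h3 h4 -e3 -e2 e eqxx.
- by move=> x x' y y' _ [h1 h2 e1 e2] _ [h3 h4 e3 e4] /=; rewrite h1 h2 h3 h4 e1 e2 e3 e4.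
- by move=> n s x x' _ [h1 h2 e1 e2] e /=; rewrite h1 h2 -e1 e eqxx.
- by move=> n s x x' _ [h1 h2 e1 e2] e /=; rewrite h1 h2 -e2 e eqxx.
Qed.

HB.instance Definition _ := gen_eqMixin expr.
HB.instance Definition _ := gen_choiceMixin expr.

Section FreeProp.
Local Open Scope quotient_scope.

Definition texpr (n m : nat) : Type := {t : expr | has_biarity n m t}.
HB.instance Definition _ n m := Choice.on (texpr n m).

Definition peqb n m (x y : texpr n m) : bool := `[< peq (sval x) (sval y) >].

Lemma peqb_equiv n m : equiv_class_of (@peqb n m).
Proof.
split.
- by move=> [x hx]; apply/asboolP/peq_refl; case/and3P: (hx).
- by move=> x y; apply/asboolP/asboolP => /peq_sym.
- by move=> y x z /asboolP h1 /asboolP h2; apply/asboolP/(peq_trans h1 h2).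
Qed.

Canonical peq_equiv n m := EquivRelPack (@peqb_equiv n m).

Definition fop (n m : nat) : Type := {eq_quot (peq_equiv n m)}.
HB.instance Definition _ n m := EqQuotient.on (fop n m).

(* The class of an expression of biarity (n, m). *)
Definition cls n m (t : expr) (h : has_biarity n m t) : fop n m :=
  \pi_(fop n m) (exist _ t h).

Lemma clsP n m t u (ht : has_biarity n m t) (hu : has_biarity n m u) :
  cls ht = cls hu <-> peq t u.
Proof.
split; last by move=> h; apply/eqmodP/asboolP.
by move/eqmodP/asboolP.
Qed.

Lemma clsW n m (K : fop n m -> Prop) :
  (forall t (h : has_biarity n m t), K (cls h)) -> forall x, K x.
Proof. by move=> h; elim/quotW => -[t ht]; apply: h. Qed.

End FreeProp.

Section FreePropOps.

Lemma bi_vcomp n u m x y : has_biarity n u x -> has_biarity u m y ->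
  has_biarity n m (EComp x y).
Proof.
case/and3P => h1 /eqP h2 /eqP h3; case/and3P => h4 /eqP h5 /eqP h6.
by rewrite /has_biarity /= h1 h4 h2 h3 h5 h6 !eqxx.
Qed.

Lemma bi_hcomp n1 m1 n2 m2 x y : has_biarity n1 m1 x -> has_biarity n2 m2 y ->
  has_biarity (n1 + n2) (m1 + m2) (EBox x y).
Proof.
case/and3P => h1 /eqP h2 /eqP h3; case/and3P => h4 /eqP h5 /eqP h6.
by rewrite /has_biarity /= h1 h4 h2 h3 h5 h6 !eqxx.
Qed.

Lemma bi_actl n m (s : 'S_n) x : has_biarity n m x ->
  has_biarity n m (EActl s x).
Proof.
case/and3P => h1 /eqP h2 /eqP h3.
by rewrite /has_biarity /= h1 h2 h3 !eqxx.
Qed.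

Lemma bi_actr n m (s : 'S_m) x : has_biarity n m x ->
  has_biarity n m (EActr x s).
Proof.
case/and3P => h1 /eqP h2 /eqP h3.
by rewrite /has_biarity /= h1 h2 h3 !eqxx.
Qed.

Lemma bi_gen n m : is_gen n m -> has_biarity n m (EGen n m).
Proof. by rewrite /has_biarity /= !eqxx => ->. Qed.

Lemma bi_cast n n' m m' t : n = n' -> m = m' -> has_biarity n m t ->
  has_biarity n' m' t.
Proof. by move=> -> ->. Qed.

Definition fexpr n m (x : fop n m) : expr := sval (generic_quotient.repr x).
Definition fexprP n m (x : fop n m) : has_biarity n m (fexpr x) :=
  svalP (generic_quotient.repr x).

Lemma fexpr_cls n m t (h : has_biarity n m t) : peq (fexpr (cls h)) t.
Proof.
rewrite -(clsP (fexprP (cls h)) h) /cls.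
have -> : exist _ (fexpr (cls h)) (fexprP (cls h)) = generic_quotient.repr (cls h).
  exact: val_inj.
by rewrite reprK.
Qed.

Lemma fexprK n m (x : fop n m) : cls (fexprP x) = x.
Proof. by elim/clsW: x => t h; apply/clsP/fexpr_cls. Qed.

Definition funit : fop 1 1 := @cls 1 1 EUnit isT.
Definition fgen n m (h : is_gen n m) : fop n m := cls (bi_gen h).
Definition fvcomp n u m (x : fop n u) (y : fop u m) : fop n m :=
  cls (bi_vcomp (fexprP x) (fexprP y)).
Definition fhcomp n1 m1 n2 m2 (x : fop n1 m1) (y : fop n2 m2) :
    fop (n1 + n2) (m1 + m2) :=
  cls (bi_hcomp (fexprP x) (fexprP y)).
Definition factl n m (s : 'S_n) (x : fop n m) : fop n m :=
  cls (bi_actl s (fexprP x)).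
Definition factr n m (x : fop n m) (s : 'S_m) : fop n m :=
  cls (bi_actr s (fexprP x)).

Lemma fvcompE n u m x y (hx : has_biarity n u x) (hy : has_biarity u m y) :
  fvcomp (cls hx) (cls hy) = cls (bi_vcomp hx hy).
Proof.
apply/clsP/peq_comp; try exact: fexpr_cls.
have /and3P[_ _ /eqP->] := fexprP (cls hx).
by have /and3P[_ /eqP-> _] := fexprP (cls hy).
Qed.

Lemma fhcompE n1 m1 n2 m2 x y
    (hx : has_biarity n1 m1 x) (hy : has_biarity n2 m2 y) :
  fhcomp (cls hx) (cls hy) = cls (bi_hcomp hx hy).
Proof. by apply/clsP/peq_box; apply: fexpr_cls. Qed.

Lemma factlE n m (s : 'S_n) x (hx : has_biarity n m x) :
  factl s (cls hx) = cls (bi_actl s hx).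
Proof.
apply/clsP/peq_actl; first exact: fexpr_cls.
by have /and3P[_ /eqP-> _] := fexprP (cls hx).
Qed.

Lemma factrE n m (s : 'S_m) x (hx : has_biarity n m x) :
  factr (cls hx) s = cls (bi_actr s hx).
Proof.
apply/clsP/peq_actr; first exact: fexpr_cls.
by have /and3P[_ _ /eqP->] := fexprP (cls hx).
Qed.

Lemma fcastE n n' m m' (en : n = n') (em : m = m') t
    (h : has_biarity n m t) :
  cast_op en em (cls h) = cls (bi_cast en em h).
Proof.
by case: n' / en; case: m' / em; apply/clsP/peq_refl; case/and3P: h.
Qed.

Lemma funitsE n : units_of funit fhcomp n = cls (units_biarity n).
Proof.
elim: n => [|n IH] /=; first by apply/clsP; apply: peq_refl.
rewrite IH fhcompE; apply/clsP; apply: peq_refl.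
by have /and3P[] := units_biarity n.+1.
Qed.

Lemma clsA n m t u (ht : has_biarity n m t) (hu : has_biarity n m u) :
  prop_axiom t u -> cls ht = cls hu.
Proof.
by move=> h; apply/clsP/peq_axiom => //; [case/and3P: ht | case/and3P: hu].
Qed.

Lemma fop_gt0 n m : fop n m -> (0 < n) && (0 < m).
Proof. by elim/clsW => t /and3P[/wt_gt0 h /eqP <- /eqP <-]. Qed.

Definition FXi : PROP.
Proof.
apply: (@MkPROP fop fop_gt0 funit fvcomp fhcomp factl factr).
- by move=> n m; elim/clsW => x hx; rewrite factlE; apply/clsA/ax_actl1.
- by move=> n m s t; elim/clsW => x hx; rewrite !factlE; apply/clsA/ax_actlM.
- by move=> n m; elim/clsW => x hx; rewrite factrE; apply/clsA/ax_actr1.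
- by move=> n m s t; elim/clsW => x hx; rewrite !factrE; apply/clsA/ax_actrM.
- move=> n m s t; elim/clsW => x hx; rewrite factlE !factrE factlE.
  exact/clsA/ax_actlr.
- move=> n u v m; elim/clsW => x hx; elim/clsW => y hy; elim/clsW => z hz.
  by rewrite !fvcompE; apply/clsA/ax_vcompA.
- move=> n m; elim/clsW => x hx; rewrite funitsE fvcompE.
  exact/clsA/ax_vcomp1l.
- move=> n m; elim/clsW => x hx; rewrite funitsE fvcompE.
  exact/clsA/ax_vcomp1r.
- move=> n u m s; elim/clsW => x hx; elim/clsW => y hy.
  by rewrite factlE !fvcompE factlE; apply/clsA/ax_vcomp_actl.
- move=> n u m s; elim/clsW => x hx; elim/clsW => y hy.
  by rewrite factrE !fvcompE factrE; apply/clsA/ax_vcomp_actr.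
- move=> n u m s; elim/clsW => x hx; elim/clsW => y hy.
  by rewrite factrE factlE !fvcompE; apply/clsA/ax_vcomp_actlr.
- move=> n1 m1 n2 m2 n3 m3.
  elim/clsW => x hx; elim/clsW => y hy; elim/clsW => z hz.
  by rewrite !fhcompE fcastE; apply/clsA/ax_hcompA.
- move=> n1 m1 n2 m2; elim/clsW => x hx; elim/clsW => y hy.
  rewrite !fhcompE fcastE factlE factrE; apply/clsA.
  case/and3P: hx => _ /eqP h1 /eqP h2; case/and3P: hy => _ /eqP h3 /eqP h4.
  by rewrite -h1 -h2 -h3 -h4; apply: ax_hcompC.
- move=> n1 m1 n2 m2 s t; elim/clsW => x hx; elim/clsW => y hy.
  by rewrite (factlE s hx) (factlE t hy) !fhcompE factlE; apply/clsA/ax_hcomp_actl.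
- move=> n1 m1 n2 m2 s t; elim/clsW => x hx; elim/clsW => y hy.
  by rewrite (factrE s hx) (factrE t hy) !fhcompE factrE; apply/clsA/ax_hcomp_actr.
- move=> n1 u1 m1 n2 u2 m2; elim/clsW => x1 hx1; elim/clsW => y1 hy1.
  elim/clsW => x2 hx2; elim/clsW => y2 hy2.
  rewrite (fhcompE hx1 hx2) (fhcompE hy1 hy2) (fvcompE hx1 hy1).
  by rewrite (fvcompE hx2 hy2) fvcompE fhcompE; apply/clsA/ax_interchange.
Defined.

End FreePropOps.

Section Universal.
Variables (P : PROP) (xi : forall n m, is_gen n m -> P n m).

Definition tot : Type := {nm : nat * nat & P nm.1 nm.2}.
Definition pack n m (x : P n m) : tot := existT (fun nm => P nm.1 nm.2) (n, m) x.

Lemma packP n m n' m' (x : P n m) (x' : P n' m') : pack x = pack x' ->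
  exists (en : n = n') (em : m = m'), x' = cast_op en em x.
Proof.
move=> e; have e1 : n = n' := congr1 (fun t : tot => (projT1 t).1) e.
have e2 : m = m' := congr1 (fun t : tot => (projT1 t).2) e.
exists e1, e2; case: n' / e1 x' e => x'; case: m' / e2 x' => x' e.
have := projT2_eq e; rewrite (eq_irrelevance (projT1_eq e) erefl) /= => ->.
by [].
Qed.

Lemma pack_inj n m : injective (@pack n m).
Proof.
move=> x y /packP[en [em ->]].
by rewrite (eq_irrelevance en erefl) (eq_irrelevance em erefl).
Qed.

Lemma pack_cast n n' m m' (en : n = n') (em : m = m') (x : P n m) :
  pack (cast_op en em x) = pack x.
Proof. by case: n' / en; case: m' / em. Qed.

Lemma pack_vcomp n u m n' u' m' (x : P n u) (y : P u m)
    (x' : P n' u') (y' : P u' m') :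
  pack x = pack x' -> pack y = pack y' -> pack (vcomp x y) = pack (vcomp x' y').
Proof.
case/packP => en [eu ->]; case: n' / en x' => x'; case: u' / eu x' y' => _ y'.
case/packP => eu [em ->]; case: m' / em y' => _.
by rewrite (eq_irrelevance eu erefl).
Qed.

Lemma pack_hcomp n1 m1 n2 m2 n1' m1' n2' m2' (x : P n1 m1) (y : P n2 m2)
    (x' : P n1' m1') (y' : P n2' m2') :
  pack x = pack x' -> pack y = pack y' -> pack (hcomp x y) = pack (hcomp x' y').
Proof.
case/packP => e1 [e2 ->]; case/packP => e3 [e4 ->].
by case: _ / e1 x'; case: _ / e2; case: _ / e3 y'; case: _ / e4.
Qed.

Lemma pack_actl n m m' (s : 'S_n) (x : P n m) (x' : P n m') :
  pack x = pack x' -> pack (actl s x) = pack (actl s x').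
Proof.
case/packP => en [em ->]; case: _ / em x' => _.
by rewrite (eq_irrelevance en erefl).
Qed.

Lemma pack_actr n m n' (s : 'S_m) (x : P n m) (x' : P n' m) :
  pack x = pack x' -> pack (actr x s) = pack (actr x' s).
Proof.
case/packP => en [em ->]; case: _ / en x' => _.
by rewrite (eq_irrelevance em erefl).
Qed.

(* [evals t a]: the expression t has the value a in P if the generators are
   interpreted by xi. *)
Inductive evals : expr -> forall n m, P n m -> Prop :=
| ev_unit : evals EUnit (op1 P)
| ev_gen n m (h : is_gen n m) : evals (EGen n m) (xi h)
| ev_vcomp x y n u m (a : P n u) (b : P u m) of evals x a & evals y b :
    evals (EComp x y) (vcomp a b)
| ev_hcomp x y n1 m1 n2 m2 (a : P n1 m1) (b : P n2 m2)
    of evals x a & evals y b : evals (EBox x y) (hcomp a b)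
| ev_actl n (s : 'S_n) x m (a : P n m) of evals x a :
    evals (EActl s x) (actl s a)
| ev_actr m (s : 'S_m) x n (a : P n m) of evals x a :
    evals (EActr x s) (actr a s).

Lemma evals_cast t n m n' m' (en : n = n') (em : m = m') (a : P n m) :
  evals t a -> evals t (cast_op en em a).
Proof. by case: _ / en; case: _ / em. Qed.

Lemma evals_ex t : wt t -> exists a : P (outs t) (inps t), evals t a.
Proof.
elim: t => /= [|n m|x IHx y IHy|x IHx y IHy|n s x IHx|x IHx m s].
- by move=> _; exists (op1 P); apply: ev_unit.
- by move=> h; exists (xi h); apply: ev_gen.
- case/and3P => /IHx[a ha] /IHy[b hb] /eqP e.
  exists (vcomp a (cast_op e erefl b)); apply: ev_vcomp => //.
  exact: evals_cast.
- case/andP => /IHx[a ha] /IHy[b hb].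
  by exists (hcomp a b); apply: ev_hcomp.
- case/andP => /IHx[a ha] /eqP e; exists (actl s (cast_op e erefl a)).
  exact/ev_actl/evals_cast.
- case/andP => /IHx[a ha] /eqP e; exists (actr (cast_op erefl e a) s).
  exact/ev_actr/evals_cast.
Qed.

Definition value_spec (t : expr) (v : tot) : Prop :=
  match t with
  | EUnit => v = pack (op1 P)
  | EGen n m => exists h : is_gen n m, v = pack (xi h)
  | EComp x y => exists n u m (a : P n u) (b : P u m),
      [/\ evals x a, evals y b & v = pack (vcomp a b)]
  | EBox x y => exists n1 m1 n2 m2 (a : P n1 m1) (b : P n2 m2),
      [/\ evals x a, evals y b & v = pack (hcomp a b)]
  | EActl n s x => exists m (a : P n m), evals x a /\ v = pack (actl s a)
  | EActr x m s => exists n (a : P n m), evals x a /\ v = pack (actr a s)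
  end.

Lemma evals_inv t n m (a : P n m) : evals t a -> value_spec t (pack a).
Proof.
case=> //=.
- by move=> n' m' h; exists h.
- by move=> x y n1 u m1 a1 b1 h1 h2; exists n1, u, m1, a1, b1.
- by move=> x y n1 m1 n2 m2 a1 b1 h1 h2; exists n1, m1, n2, m2, a1, b1.
- by move=> n1 s x m1 a1 h; exists m1, a1.
- by move=> n1 s x m1 a1 h; exists m1, a1.
Qed.

Lemma evals_uniq t n m (a : P n m) n' m' (b : P n' m') :
  evals t a -> evals t b -> pack a = pack b.
Proof.
move=> ha; elim: ha n' m' b => {t n m a}.
- by move=> n' m' b /evals_inv /= ->.
- by move=> n m h n' m' b /evals_inv /= [h' ->]; rewrite (bool_irrelevance h h').
- move=> x y n u m a b _ IHx _ IHy n' m' c /evals_inv /=.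
  move=> [n1 [u1 [m1 [a1 [b1 [/IHx h1 /IHy h2 ->]]]]]].
  exact: pack_vcomp.
- move=> x y n1 m1 n2 m2 a b _ IHx _ IHy n' m' c /evals_inv /=.
  move=> [n3 [m3 [n4 [m4 [a1 [b1 [/IHx h1 /IHy h2 ->]]]]]]].
  exact: pack_hcomp.
- move=> n s x m a _ IHx n' m' b /evals_inv /= [m1 [a1 [/IHx h ->]]].
  exact: pack_actl.
- move=> n s x m a _ IHx n' m' b /evals_inv /= [m1 [a1 [/IHx h ->]]].
  exact: pack_actr.
Qed.

Lemma evals_at t n m : has_biarity n m t -> exists a : P n m, evals t a.
Proof.
case/and3P => /evals_ex[a ha] /eqP en /eqP em.
by exists (cast_op en em a); apply: evals_cast.
Qed.

Lemma evals_pack t n m (a : P n m) n' m' (b : P n' m') :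
  pack a = pack b -> evals t a -> evals t b.
Proof. by case/packP => en [em ->]; apply: evals_cast. Qed.

Lemma evals_units n : evals (eunits n) (units_of (op1 P) (@hcomp P) n).
Proof.
elim: n => [|n IH]; [exact: ev_unit | exact: (ev_hcomp ev_unit IH)].
Qed.

Lemma bi_self t : wt t -> has_biarity (outs t) (inps t) t.
Proof. by rewrite /has_biarity => ->; rewrite !eqxx. Qed.

Lemma evals_axiom t u : prop_axiom t u -> wt t -> wt u ->
  exists n m (a : P n m), evals t a /\ evals u a.
Proof.
have at_ x n m : wt x -> outs x = n -> inps x = m ->
    exists a : P n m, evals x a.
  by move=> h1 h2 h3; apply: evals_at; rewrite /has_biarity h1 h2 h3 !eqxx.
case=> /=.
- move=> n x /andP[h /eqP e] _; have [a ha] := at_ x _ _ h e erefl.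
  exists n, (inps x), a; split=> //.
  by rewrite -[a]actl1; apply: ev_actl.
- move=> n s t' x /andP[h /eqP e] _; have [a ha] := at_ x _ _ h e erefl.
  exists n, (inps x), (actl (s * t') a); split; first exact: ev_actl.
  by rewrite actlM; do 2 apply: ev_actl.
- move=> n x /andP[h /eqP e] _; have [a ha] := at_ x _ _ h erefl e.
  exists (outs x), n, a; split=> //.
  by rewrite -[a]actr1; apply: ev_actr.
- move=> n s t' x /andP[h /eqP e] _; have [a ha] := at_ x _ _ h erefl e.
  exists (outs x), n, (actr a (s * t')); split; first exact: ev_actr.
  by rewrite actrM; do 2 apply: ev_actr.
- move=> n m s t' x /andP[/andP[h /eqP e] /eqP e'] _.
  have [a ha] := at_ x _ _ h e e'.
  exists n, m, (actr (actl s a) t'); split; first by apply/ev_actr/ev_actl.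
  by rewrite actlr; apply/ev_actl/ev_actr.
- move=> x y z /and3P[/and3P[hx hy /eqP e1] hz /eqP e2] _.
  have [a ha] := at_ x _ _ hx erefl erefl; have [b hb] := at_ y _ _ hy e1 erefl.
  have [c hc] := at_ z _ _ hz e2 erefl.
  exists _, _, (vcomp (vcomp a b) c); split; first by do 2 apply: ev_vcomp => //.
  by rewrite vcompA; do 2 apply: ev_vcomp => //.
- move=> n x /and3P[_ h /eqP e] _.
  have /and3P[_ _ /eqP e'] := units_biarity n.
  have [a ha] := at_ x _ _ h (etrans e e') erefl.
  exists _, _, a; split=> //; rewrite -[a]vcomp1l; apply: ev_vcomp => //.
  exact: evals_units.
- move=> n x /and3P[h _ /eqP e] _.
  have /and3P[_ /eqP e' _] := units_biarity n.
  have [a ha] := at_ x _ _ h erefl (etrans (esym e) e').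
  exists _, _, a; split=> //; rewrite -[a]vcomp1r; apply: ev_vcomp => //.
  exact: evals_units.
- move=> n s x y /and3P[/andP[hx /eqP e1] hy /eqP e2] _.
  have [a ha] := at_ x _ _ hx e1 erefl; have [b hb] := at_ y _ _ hy e2 erefl.
  exists _, _, (actl s (vcomp a b)); split; last by apply/ev_actl/ev_vcomp.
  by rewrite -vcomp_actl; apply: ev_vcomp => //; apply: ev_actl.
- move=> n s x y /and3P[hx /andP[hy /eqP e1] /eqP e2] _.
  have [a ha] := at_ x _ _ hx erefl erefl; have [b hb] := at_ y _ _ hy e2 e1.
  exists _, _, (actr (vcomp a b) s); split; last by apply/ev_actr/ev_vcomp.
  by rewrite -vcomp_actr; apply: ev_vcomp => //; apply: ev_actr.
- move=> n s x y /and3P[/andP[hx /eqP e1] hy /eqP e2] _.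
  have [a ha] := at_ x _ _ hx erefl e1; have [b hb] := at_ y _ _ hy e2 erefl.
  exists _, _, (vcomp (actr a s) b); split.
    by apply: ev_vcomp => //; apply: ev_actr.
  by rewrite vcomp_actlr; apply: ev_vcomp => //; apply: ev_actl.
- move=> x y z /andP[hx /andP[hy hz]] _.
  have [a ha] := at_ x _ _ hx erefl erefl; have [b hb] := at_ y _ _ hy erefl erefl.
  have [c hc] := at_ z _ _ hz erefl erefl.
  exists _, _, (hcomp (hcomp a b) c); split; last by do 2 apply: ev_hcomp => //.
  by rewrite -hcompA; apply: evals_cast; do 2 apply: ev_hcomp => //.
- move=> x y /andP[/andP[hx hy] _] _.
  have [a ha] := at_ x _ _ hx erefl erefl; have [b hb] := at_ y _ _ hy erefl erefl.
  exists _, _, (actl (swap_perm (outs x) (outs y)) (hcomp a b)); split.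
    by apply/ev_actl/ev_hcomp.
  by rewrite hcompC; apply/ev_actr/evals_cast/ev_hcomp.
- move=> n1 n2 s t' x y /andP[/andP[hx /eqP e1] /andP[hy /eqP e2]] _.
  have [a ha] := at_ x _ _ hx e1 erefl; have [b hb] := at_ y _ _ hy e2 erefl.
  exists _, _, (actl (block_perm s t') (hcomp a b)); split.
    by rewrite -hcomp_actl; apply: ev_hcomp; apply: ev_actl.
  by apply/ev_actl/ev_hcomp.
- move=> n1 n2 s t' x y /andP[/andP[hx /eqP e1] /andP[hy /eqP e2]] _.
  have [a ha] := at_ x _ _ hx erefl e1; have [b hb] := at_ y _ _ hy erefl e2.
  exists _, _, (actr (hcomp a b) (block_perm s t')); split.
    by rewrite -hcomp_actr; apply: ev_hcomp; apply: ev_actr.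
  by apply/ev_actr/ev_hcomp.
move=> x1 y1 x2 y2 _ /andP[/and3P[h1 h2 /eqP e1] /and3P[h3 h4 /eqP e2]].
have [a1 ha1] := at_ x1 _ _ h1 erefl erefl.
have [b1 hb1] := at_ y1 _ _ h2 e1 erefl.
have [a2 ha2] := at_ x2 _ _ h3 erefl erefl.
have [b2 hb2] := at_ y2 _ _ h4 e2 erefl.
exists _, _, (hcomp (vcomp a1 b1) (vcomp a2 b2)); split.
  by rewrite -interchange; apply: ev_vcomp; apply: ev_hcomp.
by apply: ev_hcomp; apply: ev_vcomp.
Qed.

Lemma evals_peq t u : peq t u ->
  forall n m (a : P n m), evals t a <-> evals u a.
Proof.
elim=> {t u}.
- move=> t u h ht hu n m a; have [n' [m' [c [hc hc']]]] := evals_axiom h ht hu.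
  split=> ha; [apply: evals_pack hc' | apply: evals_pack hc].
    exact: evals_uniq hc ha.
  exact: evals_uniq hc' ha.
- by [].
- by move=> x y _ h n m a; split=> ha; apply/h.
- move=> x y z _ h1 _ h2 n m a.
  by split=> [/h1/h2 //|/h2/h1].
- move=> x x' y y' _ h1 _ h2 _ n m a.
  split=> /evals_inv /= [n1 [u [m1 [b [c [/h1 hb /h2 hc e]]]]]];
  by apply: (evals_pack (esym e)); apply: ev_vcomp.
- move=> x x' y y' _ h1 _ h2 n m a.
  split=> /evals_inv /= [n1 [m1 [n2 [m2 [b [c [/h1 hb /h2 hc e]]]]]]];
  by apply: (evals_pack (esym e)); apply: ev_hcomp.
- move=> k s x x' _ h _ n m a.
  split=> /evals_inv /= [m1 [b [/h hb e]]];
  by apply: (evals_pack (esym e)); apply: ev_actl.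
- move=> k s x x' _ h _ n m a.
  split=> /evals_inv /= [m1 [b [/h hb e]]];
  by apply: (evals_pack (esym e)); apply: ev_actr.
Qed.

Definition extend n m (x : FXi n m) : P n m := sval (cid (evals_at (fexprP x))).

Lemma evals_extend n m t (h : has_biarity n m t) : evals t (extend (cls h)).
Proof.
rewrite -(evals_peq (fexpr_cls h)).
exact: (svalP (cid (evals_at (fexprP (cls h))))).
Qed.

Lemma extend_uniq n m t (h : has_biarity n m t) (a : P n m) :
  evals t a -> extend (cls h) = a.
Proof. by move=> ha; apply/pack_inj/evals_uniq/ha/evals_extend. Qed.

Lemma extend_morphism : is_morphism extend.
Proof.
split.
- exact/extend_uniq/ev_unit.
- move=> n u m; elim/clsW => x hx; elim/clsW => y hy.
  by rewrite /= fvcompE; apply/extend_uniq/ev_vcomp; apply: evals_extend.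
- move=> n1 m1 n2 m2; elim/clsW => x hx; elim/clsW => y hy.
  by rewrite /= fhcompE; apply/extend_uniq/ev_hcomp; apply: evals_extend.
- move=> n m s; elim/clsW => x hx.
  by rewrite /= factlE; apply/extend_uniq/ev_actl/evals_extend.
- move=> n m s; elim/clsW => x hx.
  by rewrite /= factrE; apply/extend_uniq/ev_actr/evals_extend.
Qed.

Lemma extend_gen n m (h : is_gen n m) : extend (fgen h) = xi h.
Proof. exact/extend_uniq/ev_gen. Qed.

Lemma evals_morphism (f : forall n m, FXi n m -> P n m) :
  is_morphism f -> (forall n m (h : is_gen n m), f n m (fgen h) = xi h) ->
  forall t n m (h : has_biarity n m t), evals t (f n m (cls h)).
Proof.
move=> fM fG; elim=> [|k l|x IHx y IHy|x IHx y IHy|k s x IHx|x IHx k s] n m h.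
- case/and3P: (h) => _ /eqP /= en /eqP /= em; case: _ / en h; case: _ / em => h.
  have -> : cls h = op1 FXi by apply/clsP/peq_refl.
  by rewrite (morph_unit fM); apply: ev_unit.
- case/and3P: (h) => g /eqP /= en /eqP /= em; case: _ / en h; case: _ / em => h.
  have -> : cls h = fgen g by apply/clsP/peq_refl.
  by rewrite fG; apply: ev_gen.
- case/and3P: (h) => /= /and3P[wx wy /eqP e] en em.
  have hx : has_biarity n (inps x) x by rewrite /has_biarity wx en eqxx.
  have hy : has_biarity (inps x) m y by rewrite /has_biarity wy e em eqxx.
  have -> : cls h = vcomp (cls hx : FXi _ _) (cls hy : FXi _ _).
    by rewrite /= fvcompE; apply/clsP/peq_refl; case/and3P: h.
  by rewrite (morph_vcomp fM); apply: ev_vcomp.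
- case/and3P: (h) => /= /andP[wx wy] /eqP en /eqP em.
  have hx := bi_self wx; have hy := bi_self wy.
  case: _ / en h; case: _ / em => h.
  have -> : cls h = hcomp (cls hx : FXi _ _) (cls hy : FXi _ _).
    by rewrite /= fhcompE; apply/clsP/peq_refl; case/and3P: h.
  by rewrite (morph_hcomp fM); apply: ev_hcomp.
- case/and3P: (h) => /= /andP[wx ex] /eqP en em.
  case: _ / en h => h.
  have hx : has_biarity k m x by rewrite /has_biarity wx ex em.
  have -> : cls h = actl s (cls hx : FXi _ _).
    by rewrite /= factlE; apply/clsP/peq_refl; case/and3P: h.
  by rewrite (morph_actl fM); apply: ev_actl.
- case/and3P: (h) => /= /andP[wx ex] en /eqP em.
  case: _ / em h => h.
  have hx : has_biarity n k x by rewrite /has_biarity wx en ex.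
  have -> : cls h = actr (cls hx : FXi _ _) s.
    by rewrite /= factrE; apply/clsP/peq_refl; case/and3P: h.
  by rewrite (morph_actr fM); apply: ev_actr.
Qed.

End Universal.

Theorem free_prop_universal (P : PROP) (xi : forall n m, is_gen n m -> P n m) :
  exists f : forall n m, FXi n m -> P n m,
    [/\ is_morphism f,
        forall n m (h : is_gen n m), f n m (fgen h) = xi n m h
      & forall g : forall n m, FXi n m -> P n m, is_morphism g ->
          (forall n m (h : is_gen n m), g n m (fgen h) = xi n m h) ->
          forall n m (x : FXi n m), g n m x = f n m x].
Proof.
exists (extend xi); split; first exact: extend_morphism.
  by move=> n m h; apply: extend_gen.
move=> g gM gG n m; elim/clsW => t h; apply/esym/extend_uniq.
exact: evals_morphism.
Qed.

(* x_1 [x] ... [x] x_k for k >= 1; the value for k = 0 is irrelevant. *)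
Fixpoint ebox (s : seq expr) : expr :=
  match s with
  | [::] => EUnit
  | [:: x] => x
  | x :: s' => EBox x (ebox s')
  end.

(* The numerator is B_1 ... B_k and the denominator is A_1 ... A_l: the t-th
   output of A_s is connected to the s-th input of B_t. *)
Definition fraction (Bs As : seq expr) : expr :=
  EComp (ebox Bs) (EActl (frac_perm (size As) (size Bs)) (ebox As)).

Fixpoint eup (U : ptree nat) : expr :=
  if U is Node _ s then EComp (EGen 1 (size s)) (ebox (map eup s)) else EUnit.

Fixpoint edown (D : ptree nat) : expr :=
  if D is Node _ s then EComp (ebox (map edown s)) (EGen (size s) 1) else EUnit.

(* Renumbers the values order-preservingly as {1, ..., h}: the new value of i is
   the number of distinct values j <= i.  If U' and D' are subtrees of U and D,
   carrying the values they have in X = (U, D), then renumber (U', D') is the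
   restriction of X to U' and D'. *)
Definition renumber (X : tpair) : tpair :=
  let f i := size (undup [seq j <- plabels X | j <= i]) in
  (tmap f X.1, tmap f X.2).

(* The subtree of U formed by the vertices above level d, and the list of the
   subtrees of U attached to its leaves.  Here the levels increase from the root
   of U to its leaves. *)
Fixpoint top_part (d : nat) (U : ptree nat) : ptree nat :=
  if U is Node u s then
    if u < d then Node u (map (top_part d) s) else Leaf
  else Leaf.

Fixpoint hanging (d : nat) (U : ptree nat) : seq (ptree nat) :=
  if U is Node u s then
    if u < d then flatten (map (hanging d) s) else [:: U]
  else [:: Leaf].

(* The bound N on the depth of the recursion is irrelevant once it is at least
   the total number of vertices of X; see [varpi_exprE] for the resulting
   recursion. *)
Fixpoint varpi_rec (N : nat) (X : tpair) : expr :=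
  match X with
  | (U, Leaf) => eup U
  | (Leaf, D) => edown D
  | (Node u Us as U, Node d Ds as D) =>
    if d < u then EComp (edown D) (eup U)
    else if d == u then
      EComp (ebox (map edown Ds))
            (EComp (EGen (size Ds) (size Us)) (ebox (map eup Us)))
    else if N is N'.+1 then
      let T := top_part d U in
      let c := Node d (nseq (size Ds) Leaf) in
      fraction [seq varpi_rec N' (renumber (T, Dj)) | Dj <- Ds]
               [seq varpi_rec N' (renumber (Ui, c)) | Ui <- hanging d U]
    else EUnit
  end.

Definition varpi_expr (X : tpair) : expr :=
  varpi_rec (nverts X.1 + nverts X.2) X.

Section VarpiTheory.

Lemma ebox_cons x y s : ebox [:: x, y & s] = EBox x (ebox (y :: s)).
Proof. by []. Qed.

Lemma ebox_wt s : 0 < size s -> all wt s ->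
  [/\ wt (ebox s), outs (ebox s) = sumn (map outs s)
    & inps (ebox s) = sumn (map inps s)].
Proof.
elim: s => // x [|y s] IH _ /andP[hx hs]; first by rewrite /= !addn0.
have [h1 h2 h3] := IH isT hs.
by rewrite ebox_cons [wt _]/= [outs _]/= [inps _]/= hx h1 h2 h3.
Qed.

Lemma ebox_biarity n m (s : seq expr) (ns ms : seq nat) :
  0 < size s -> size ns = size s -> size ms = size s ->
  (forall i, i < size s ->
     has_biarity (nth 0 ns i) (nth 0 ms i) (nth EUnit s i)) ->
  sumn ns = n -> sumn ms = m -> has_biarity n m (ebox s).
Proof.
move=> s0 hn hm h <- <-.
have [|h1 h2 h3] := @ebox_wt s s0.
  by apply/(all_nthP EUnit) => i /h /and3P[].
rewrite /has_biarity h1 h2 h3 andTb; apply/andP; split.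
  apply/eqP; congr sumn; apply: (@eq_from_nth _ 0); rewrite size_map // => i lti.
  by rewrite (nth_map EUnit) //; have /and3P[_ /eqP] := h i lti.
apply/eqP; congr sumn; apply: (@eq_from_nth _ 0); rewrite size_map // => i lti.
by rewrite (nth_map EUnit) //; have /and3P[_ _ /eqP] := h i lti.
Qed.

Lemma sumn_ones (A : Type) (s : seq A) : sumn (map (fun=> 1) s) = size s.
Proof. by elim: s => //= _ s ->. Qed.

Lemma gen_gt1 n m : 0 < n -> 0 < m -> (1 < n) || (1 < m) -> is_gen n m.
Proof. by rewrite /is_gen xpair_eqE; case: n m => [|[|n]] [|[|m]]. Qed.

Lemma ebox_eup (s : seq (ptree nat)) : 0 < size s ->
  (forall i, i < size s ->
    has_biarity 1 (leaves (nth Leaf s i)) (eup (nth Leaf s i))) ->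
  has_biarity (size s) (sumn (map (@leaves nat) s)) (ebox (map eup s)).
Proof.
move=> s0 h.
apply: (@ebox_biarity _ _ _ (map (fun=> 1) s) (map (@leaves nat) s));
  rewrite ?size_map ?sumn_ones // => i lti.
by rewrite !(nth_map Leaf) //; apply: h.
Qed.

Lemma ebox_edown (s : seq (ptree nat)) : 0 < size s ->
  (forall i, i < size s ->
    has_biarity (leaves (nth Leaf s i)) 1 (edown (nth Leaf s i))) ->
  has_biarity (sumn (map (@leaves nat) s)) (size s) (ebox (map edown s)).
Proof.
move=> s0 h.
apply: (@ebox_biarity _ _ _ (map (@leaves nat) s) (map (fun=> 1) s));
  rewrite ?size_map ?sumn_ones // => i lti.
by rewrite !(nth_map Leaf) //; apply: h.
Qed.

Lemma eup_biarity U : planar U -> has_biarity 1 (leaves U) (eup U).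
Proof.
elim/ptree_ind': U => // a s IH /= /andP[s1 /all_nth_ptree hs].
have s0 : 0 < size s by apply: ltnW.
apply: (@bi_vcomp _ (size s)).
  by apply/bi_gen/gen_gt1; rewrite ?s0 ?s1.
by apply: ebox_eup => // i lti; apply: IH => //; apply: hs.
Qed.

Lemma edown_biarity D : planar D -> has_biarity (leaves D) 1 (edown D).
Proof.
elim/ptree_ind': D => // a s IH /= /andP[s1 /all_nth_ptree hs].
have s0 : 0 < size s by apply: ltnW.
apply: (@bi_vcomp _ (size s)); last first.
  by apply/bi_gen/gen_gt1; rewrite ?s0 ?s1.
by apply: ebox_edown => // i lti; apply: IH => //; apply: hs.
Qed.

Lemma nvertsE (a : nat) s : nverts (Node a s) = (sumn (map (@nverts nat) s)).+1.
Proof. by rewrite /nverts /= size_flatten /shape -map_comp. Qed.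

Lemma leq_sumn_nth (l : seq nat) i : nth 0 l i <= sumn l.
Proof.
elim: l i => [|x l IH] [|i] //=; first exact: leq_addr.
exact: leq_trans (IH i) (leq_addl _ _).
Qed.

Lemma nverts_child (a : nat) s i : i < size s ->
  nverts (nth Leaf s i) < nverts (Node a s).
Proof.
move=> lti; rewrite nvertsE ltnS -(nth_map _ 0 (@nverts nat)) //.
exact: leq_sumn_nth.
Qed.

Lemma nverts_corolla (a : nat) k : nverts (Node a (nseq k Leaf)) = 1.
Proof. by rewrite nvertsE; elim: k => //= k ->. Qed.

Lemma leaves_corolla (a : nat) k : leaves (Node a (nseq k Leaf)) = k.
Proof. by rewrite /=; elim: k => //= k ->. Qed.

Lemma planar_corolla (a : nat) k : planar (Node a (nseq k Leaf)) = (1 < k).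
Proof. by rewrite /= size_nseq all_nseq /= orbT andbT. Qed.

Lemma planar_top d U : planar U -> planar (top_part d U).
Proof.
elim/ptree_ind': U => // a s IH /= /andP[s1 /all_nth_ptree hs].
case: ifP => // _ /=; rewrite size_map s1 all_map /=.
by apply/all_nth_ptree => i lti /=; apply: IH => //; apply: hs.
Qed.

Lemma planar_hanging d U : planar U -> all (@planar nat) (hanging d U).
Proof.
elim/ptree_ind': U => // a s IH /= /andP[s1 /all_nth_ptree hs].
case: ifP => _; last by rewrite /= s1 andbT; apply/all_nth_ptree.
elim: s IH hs {s1} => //= t s IHs IH hs; rewrite all_cat.
rewrite (IH 0) ?(hs 0) //=; apply: IHs => i lti.
  exact: (IH i.+1).
exact: (hs i.+1).
Qed.

Lemma size_hanging d U : size (hanging d U) = leaves (top_part d U).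
Proof.
elim/ptree_ind': U => // a s IH /=; case: ifP => // _ /=.
rewrite size_flatten /shape -!map_comp; congr sumn.
apply: (@eq_from_nth _ 0); rewrite ?size_map // => i lti.
by rewrite !(nth_map Leaf) //= IH.
Qed.

Lemma leaves_hanging d U :
  sumn (map (@leaves nat) (hanging d U)) = leaves U.
Proof.
elim/ptree_ind': U => // a s IH /=; case: ifP => _ /=; last by rewrite addn0.
elim: s IH => //= t s IHs IH; rewrite map_cat sumn_cat (IH 0) //; congr addn.
by apply: IHs => i lti; apply: (IH i.+1).
Qed.

Lemma nverts_top d U : nverts (top_part d U) <= nverts U.
Proof.
elim/ptree_ind': U => // a s IH /=; case: ifP => // _.
rewrite !nvertsE ltnS -map_comp.
elim: s IH => //= t s IHs IH; apply: leq_add; first exact: (IH 0).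
by apply: IHs => i lti; apply: (IH i.+1).
Qed.

Lemma nverts_hanging d U :
  all (fun V : ptree nat => nverts V <= nverts U) (hanging d U).
Proof.
elim/ptree_ind': U => // a s IH /=; case: ifP => _; last by rewrite /= leqnn.
rewrite nvertsE; elim: s IH => //= t s IHs IH; rewrite all_cat.
apply/andP; split.
  have := IH 0 isT; apply: sub_all => V /= hV.
  by apply: leq_trans hV _; rewrite -addnS leq_addr.
have := IHs (fun i lti => IH i.+1 lti); apply: sub_all => V /= hV.
by apply: leq_trans hV _; rewrite ltnS leq_addl.
Qed.

Lemma nverts_hanging_lt (u d : nat) s : u < d ->
  all (fun V : ptree nat => nverts V < nverts (Node u s)) (hanging d (Node u s)).
Proof.
move=> ud /=; rewrite ud nvertsE; elim: s => //= t s IHs; rewrite all_cat.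
apply/andP; split.
  have := nverts_hanging d t; apply: sub_all => V /= hV.
  by rewrite ltnS; apply: leq_trans hV _; rewrite leq_addr.
apply: sub_all IHs => V /=; rewrite !ltnS => hV.
by apply: leq_trans hV _; rewrite leq_addl.
Qed.

Lemma varpi_rec_bound N X : nverts X.1 + nverts X.2 <= N ->
  varpi_rec N X = varpi_expr X.
Proof.
rewrite /varpi_expr.
suff H M N' Y : nverts Y.1 + nverts Y.2 <= M -> nverts Y.1 + nverts Y.2 <= N' ->
    varpi_rec M Y = varpi_rec N' Y by move=> h; apply: H.
elim: M N' Y => [|M IH] N' [[|u Us] [|d Ds]]; try by case: N'.
case: N' => [|N'] // hM hN.
have lM (t : tpair) : nverts t.1 + nverts t.2 < nverts (Node u Us) + nverts (Node d Ds) ->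
    varpi_rec M (renumber t) = varpi_rec N' (renumber t).
  move=> ht; apply: IH; rewrite /= !nverts_tmap -ltnS.
    exact: leq_trans ht hM.
  exact: leq_trans ht hN.
rewrite [LHS]/= [RHS]/=; case: ltngtP => // ud.
congr fraction.
  apply: (@eq_from_nth _ EUnit); rewrite ?size_map // => i lti.
  rewrite !(nth_map Leaf) //; apply: lM => /=.
  rewrite -[_.+1]addnS; apply: leq_add; last exact: nverts_child.
  by have := nverts_top d (Node u Us); rewrite /= ud.
have /= := @nverts_hanging_lt u d Us ud; rewrite ud => /all_nth_ptree hV.
apply: (@eq_from_nth _ EUnit); rewrite ?size_map // => i lti.
rewrite !(nth_map Leaf) //; apply: lM.
rewrite nverts_corolla -[_.+1]addSn; apply: leq_add; first exact: hV.
by rewrite nvertsE.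
Qed.

Lemma varpi_exprE (u d : nat) Us Ds :
  let U := Node u Us in let D := Node d Ds in
  let c := Node d (nseq (size Ds) Leaf) in
  varpi_expr (U, D) =
    if d < u then EComp (edown D) (eup U)
    else if d == u then
      EComp (ebox (map edown Ds))
            (EComp (EGen (size Ds) (size Us)) (ebox (map eup Us)))
    else
      fraction [seq varpi_expr (renumber (top_part d U, Dj)) | Dj <- Ds]
               [seq varpi_expr (renumber (Ui, c)) | Ui <- hanging d U].
Proof.
move=> U D c; rewrite {1}/varpi_expr.
have [N eN] : exists N, nverts U + nverts D = N.+1.
  by rewrite {1}/U nvertsE; eexists; rewrite addSn.
rewrite [nverts _ + _]eN [LHS]/=; case: ltngtP => // ud.
have lN (t : tpair) : nverts t.1 + nverts t.2 < nverts U + nverts D ->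
    varpi_rec N (renumber t) = varpi_expr (renumber t).
  by move=> ht; apply: varpi_rec_bound; rewrite /= !nverts_tmap -ltnS -eN.
have -> : hanging d U = flatten [seq hanging d i | i <- Us] by rewrite /= ud.
have -> : top_part d U = Node u [seq top_part d i | i <- Us] by rewrite /= ud.
congr fraction.
  apply: (@eq_from_nth _ EUnit); rewrite ?size_map // => i lti.
  rewrite !(nth_map Leaf) //; apply: lN => /=.
  rewrite -[_.+1]addnS; apply: leq_add; last exact: nverts_child.
  by have := nverts_top d U; rewrite /= ud.
have /= := @nverts_hanging_lt u d Us ud; rewrite ud => /all_nth_ptree hV.
apply: (@eq_from_nth _ EUnit); rewrite ?size_map // => i lti.
rewrite !(nth_map Leaf) //; apply: lN.
rewrite [(_, _).1]/= [(_, _).2]/= nverts_corolla -[_.+1]addSn.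
by apply: leq_add; [exact: hV | rewrite /D nvertsE].
Qed.

Lemma leaves_gt0 (T : ptree nat) : planar T -> 0 < leaves T.
Proof.
elim/ptree_ind': T => // a [|t s] IH //= /andP[_ /andP[ht _]].
by rewrite ltn_addr // (IH 0).
Qed.

Lemma sumn_const (A : Type) (s : seq A) k : sumn (map (fun=> k) s) = size s * k.
Proof. by elim: s => //= _ s ->; rewrite mulSn. Qed.

Lemma varpi_biarity n m X : trees_ok n m X -> has_biarity n m (varpi_expr X).
Proof.
rewrite /varpi_expr; move: (leqnn (nverts X.1 + nverts X.2)).
move: {2 3}(_ + _) => N; elim: N n m X => [|N IH] n m [[|u Us] [|d Ds]] hN;
  case/and4P => hU hD /eqP <- /eqP <- //;
  try exact: (edown_biarity hD); try exact: (eup_biarity hU).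
move: (hU) (hD) => /= /andP[U1 /all_nth_ptree hUs] /andP[D1 /all_nth_ptree hDs].
have U0 : 0 < size Us by apply: ltnW.
have D0 : 0 < size Ds by apply: ltnW.
case: ltngtP => [du|ud|eud].
- apply: (@bi_vcomp _ 1); first exact: (edown_biarity hD).
  exact: (eup_biarity hU).
- set T := Node u _; set c := Node d _.
  have ET : T = top_part d (Node u Us) by rewrite /= ud.
  have -> : flatten [seq hanging d i | i <- Us] = hanging d (Node u Us).
    by rewrite /= ud.
  rewrite /fraction !size_map; set H := hanging d _.
  have pT : planar T by rewrite ET planar_top.
  have sH : size H = leaves T by rewrite ET size_hanging.
  have H0 : 0 < size H by rewrite sH leaves_gt0.
  have /all_nth_ptree pH := planar_hanging d hU; rewrite -/H in pH.
  have /all_nth_ptree vH := nverts_hanging_lt Us ud; rewrite -/H in vH.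
  have bi n' m' Y : trees_ok n' m' Y ->
      nverts Y.1 + nverts Y.2 < nverts (Node u Us) + nverts (Node d Ds) ->
      has_biarity n' m' (varpi_rec N (renumber Y)).
    move=> hY lY; apply: IH; rewrite /= ?nverts_tmap.
      by rewrite -ltnS; apply: leq_trans lY hN.
    by move: hY; rewrite /trees_ok /= !planar_tmap !leaves_tmap.
  apply: (@bi_vcomp _ (size H * size Ds)).
    apply: (@ebox_biarity _ _ _ (map (@leaves nat) Ds) (map (fun=> size H) Ds));
      rewrite ?size_map // ?sumn_const 1?mulnC // => i lti.
    rewrite !(nth_map Leaf) //; apply: bi.
      by rewrite /trees_ok pT hDs // sH !eqxx.
    rewrite -addnS; apply: leq_add; last exact: nverts_child.
    by rewrite [in X in X <= _]ET nverts_top.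
  apply/bi_actl; have EL := leaves_hanging d (Node u Us).
  apply: (@ebox_biarity _ _ _ (map (fun=> size Ds) H) (map (@leaves nat) H));
    rewrite ?size_map // ?sumn_const // => i lti.
  rewrite !(nth_map Leaf) //; apply: bi.
    by rewrite /trees_ok pH // planar_corolla D1 [leaves c]leaves_corolla !eqxx.
  rewrite [nverts c]nverts_corolla -addSn; apply: leq_add; first exact: vH.
  by rewrite nvertsE.
- apply: (@bi_vcomp _ (size Ds)).
    by apply: ebox_edown => // i lti; apply/edown_biarity/hDs.
  apply: (@bi_vcomp _ (size Us)).
    by apply/bi_gen/gen_gt1; rewrite ?D0 ?U0 ?D1.
  by apply: ebox_eup => // i lti; apply/eup_biarity/hUs.
Qed.

End VarpiTheory.

Lemma lT_trees_ok n m (X : lT n m) : trees_ok n m (sval X).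
Proof. by case/and4P: (svalP X). Qed.

Definition varpi n m (X : lT n m) : FXi n m :=
  cls (varpi_biarity (lT_trees_ok X)).

(* Main.v *)
Require Import Defs.
From HB Require Import structures.
From mathcomp Require Import all_boot order all_fingroup zify.
From mathcomp Require Import boolp classical_sets functions.

Set Implicit Arguments.
Unset Strict Implicit.
Unset Printing Implicit Defensive.

(** Think of X = (U, D, l) as a picture cut at every level.  Between two
    consecutive levels there is a strand for each pair of an edge of U and an
    edge of D present there, and at a level each pair consisting of a vertex or
    edge of U with a inputs and a vertex or edge of D with b outputs carries the
    operation xi^b_a, where xi^1_1 is the unit.  For an input i (a leaf of U) and
    an output j (a leaf of D) exactly one path runs from i to j.  It meets the
    vertices on the branch of U at i and those on the branch of D at j, in the
    order of their levels; a vertex of U and one of D on the same level are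
    met together, in one operation.

    The relations between values of varpi are controlled by an invariant of the
    free PROP: for each input i and output j of an expression, the set of words
    spelled by the paths from i to j, where passing through an operation
    contributes its biarity and the two ports used ([path_word]).  In other
    words, the free PROP is mapped to matrices over the semiring of languages,
    with the generators going to matrices of letters; all axioms of a PROP hold
    there ([path_word_peq]).  By induction along the definition of varpi, the
    (j, i) entry of varpi(X) is the single word obtained by interleaving the
    branch of U at i with the branch of D at j ([path_word_varpi]).  Deleting the
    letters that do not come from U leaves the arities and positions along every
    branch of U, hence the planar tree U itself ([branch_shape]), and dually for
    D.  The interleaving moreover tells, for each vertex u of U and each vertex d
    of D, whether u is above d, below d or on the same level
    ([interleave_cross]).

    These comparisons of U with D are all that matters, on both sides.  On one
    side, a zone function is determined by them, because two zones of the same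
    kind are always separated by a vertex of the other tree ([zone_unique]); and
    the projection pi does not change them ([merge_cross]).  So equal values of
    varpi give equal values of pi.  On the other side, the recursive definition
    of varpi never compares two vertices of the same tree, so it assigns to the
    zone function pi(X) literally the same expression as to X
    ([varpi_expr_proj]), which gives the converse.

    For the bijection with the zone functions it remains to see that pi is
    onto ([proj_onto]): vertices inside a zone are spread over several levels
    according to their depth in the tree, and [zone_unique] shows that this
    has the prescribed projection. *)

(** * Trees with labels *)

HB.instance Definition _ A := gen_eqMixin (ptree A).

Section Trees.
Variable A : eqType.
Implicit Types (T : ptree A) (s : seq (ptree A)).

(** Induction with the subtrees given by membership, which fits [eq_in_map]
    and [allP] better than positions in the list. *)
Lemma ptree_mem_ind (P : ptree A -> Prop) :
  P Leaf -> (forall a s, {in s, forall t, P t} -> P (Node a s)) ->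
  forall T, P T.
Proof.
move=> PL PN; elim/ptree_ind' => // a s IH; apply: PN => t /(nthP Leaf)[i lti <-].
exact: IH.
Qed.

Lemma labels_child (a : A) s t : t \in s ->
  {subset labels t <= labels (Node a s)}.
Proof.
move=> ts v vt /=; rewrite inE; apply/orP; right; apply/flattenP.
by exists (labels t); rewrite // map_f.
Qed.

Lemma labels_NodeP (a : A) s v :
  reflect (v = a \/ exists2 t, t \in s & v \in labels t)
          (v \in labels (Node a s)).
Proof.
apply: (iffP idP) => [/=|[->|[t ts vt]]].
- rewrite inE => /orP[/eqP->|/flattenP[_ /mapP[t ts ->] vt]]; first by left.
  by right; exists t.
- by rewrite /= mem_head.
- exact: labels_child vt.
Qed.

Lemma tmap_comp (B C : Type) (f : B -> C) (g : A -> B) T :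
  tmap f (tmap g T) = tmap (f \o g) T.
Proof.
elim/ptree_mem_ind: T => //= a s IH; rewrite -map_comp; congr Node.
by apply/eq_in_map => t /IH.
Qed.

Lemma eq_in_tmap (B : Type) (f g : A -> B) T :
  {in labels T, f =1 g} -> tmap f T = tmap g T.
Proof.
elim/ptree_mem_ind: T => //= a s IH fg; congr Node; first by rewrite fg ?mem_head.
apply/eq_in_map => t ts; apply: IH => // v vt; apply: fg.
exact: (labels_child a ts).
Qed.

Lemma tmap_id T : tmap id T = T.
Proof.
elim/ptree_mem_ind: T => //= a s IH; congr Node; rewrite -[RHS]map_id.
exact/eq_in_map.
Qed.

(** * Zone functions and comparisons between the two trees *)

(** A product of equations rather than a conjunction, so that it can be used as
    a rewriting rule for both comparisons at once. *)
Definition cross_eq (f g : A -> nat) (P Q : seq A) : Prop :=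
  {in P & Q, forall x y,
     ((f x < f y) = (g x < g y)) * ((f y < f x) = (g y < g x))}.

Lemma cross_eq_sub f g (P P' Q Q' : seq A) :
  {subset P' <= P} -> {subset Q' <= Q} ->
  cross_eq f g P Q -> cross_eq f g P' Q'.
Proof. by move=> hP hQ h x y /hP xP /hQ yQ; apply: h. Qed.

(** If x and y lie in the same tree and [f x < f y], the value [f x] and the next
    one are not both free of the other tree; so a vertex c of the other tree has
    its value between those of x and y.  Comparing x and y with c transfers the
    inequality to g. *)
Lemma zone_order_incl (f g : A -> nat) (U D : ptree A) :
  onto_interval (tmap f U, tmap f D) ->
  all (fun i => ~~ same_kind (tmap f U, tmap f D) i)
      (iota 1 (height (tmap f U, tmap f D)).-1) ->
  cross_eq f g (labels U) (labels D) ->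
  {in labels U ++ labels D &, forall x y, f x < f y -> g x < g y}.
Proof.
set X := (_, _) => oX /allP alt fg x y.
have nsk z t : z \in labels U ++ labels D -> t \in labels U ++ labels D ->
    f z < f t -> ~~ same_kind X (f z).
  have hE v : v \in labels U ++ labels D -> 0 < f v <= height X.
    by move=> hv; rewrite -onto_memE // /plabels /= !labels_tmap -map_cat map_f.
  move=> /hE hz /hE ht zt; apply: alt; rewrite mem_iota.
  by move: hz ht zt; lia.
have sub z t : z \in labels U ++ labels D -> t \in labels U ++ labels D ->
    f z < f t -> (f z).+1 \in plabels X.
  move=> hz ht zt; rewrite onto_memE //.
  have : f t \in plabels X by rewrite /plabels /= !labels_tmap -map_cat map_f.
  by rewrite onto_memE //; lia.
move=> hx hy xy; have hk := nsk _ _ hx hy xy; have hs := sub _ _ hx hy xy.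
have up v : v \in labels U -> f v \in labels X.1.
  by move=> hv; rewrite labels_tmap map_f.
have dn v : v \in labels D -> f v \in labels X.2.
  by move=> hv; rewrite labels_tmap map_f.
have [xU|xD] := orP (etrans (esym (mem_cat _ _ _)) hx);
have [yU|yD] := orP (etrans (esym (mem_cat _ _ _)) hy).
- have [c cD /andP[xc cy]] : exists2 c, c \in labels D & f x <= f c <= f y.
    move: hk; rewrite /same_kind /in_up /in_down up //= orbF negb_and !negbK.
    by rewrite labels_tmap => /orP[]/mapP[c cD e]; exists c => //;
       rewrite -e ?leqnn ?leqnSn /= ?xy ?(ltnW xy).
  have [h0 h1] := fg _ _ xU cD; have [h2 h3] := fg _ _ yU cD; lia.
- by have [<-] := fg _ _ xU yD.
- by have [_ <-] := fg _ _ yU xD.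
- have [c cU /andP[xc cy]] : exists2 c, c \in labels U & f x <= f c <= f y.
    move: hk; rewrite /same_kind /in_up /in_down dn //= negb_and !negbK.
    by rewrite labels_tmap => /orP[]/mapP[c cD e]; exists c => //;
       rewrite -e ?leqnn ?leqnSn /= ?xy ?(ltnW xy).
  have [h0 h1] := fg _ _ cU xD; have [h2 h3] := fg _ _ cU yD; lia.
Qed.

(** By induction on the value [f x]: all smaller positive values of f are taken,
    and g has to increase along them. *)
Lemma monotone_onto_le (f g : A -> nat) (s : seq A) :
  {in s, forall x, 0 < g x} ->
  {in s &, forall x y, f x < f y -> g x < g y} ->
  (forall k x, x \in s -> 0 < k <= f x -> exists2 y, y \in s & f y = k) ->
  {in s, forall x, f x <= g x}.
Proof.
move=> g0 mono onto.
have le k : {in s, forall x, f x = k -> k <= g x}.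
  elim: k => [|[|k] IH] x xs e; [by [] | exact: g0 |].
  have [|y ys ey] := onto k.+1 x xs; first by rewrite e leqnSn.
  apply: leq_ltn_trans (IH _ ys ey) _; apply: mono => //; lia.
by move=> x xs; apply: le.
Qed.

(** The comparisons between U and D determine the order of all values by
    [zone_order_incl], in both directions, and the values fill an interval that
    starts at 1. *)
Lemma zone_unique n m (f g : A -> nat) (U D : ptree A) :
  is_zone n m (tmap f U, tmap f D) -> is_zone n m (tmap g U, tmap g D) ->
  cross_eq f g (labels U) (labels D) ->
  (tmap f U, tmap f D) = (tmap g U, tmap g D).
Proof.
have le f' g' : is_zone n m (tmap f' U, tmap f' D) ->
    is_zone n m (tmap g' U, tmap g' D) ->
    cross_eq f' g' (labels U) (labels D) ->
    {in labels U ++ labels D, forall x, f' x <= g' x}.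
  move=> /and5P[_ oF _ _ /and3P[_ _ aF]] /and5P[_ oG _ _ _] fg.
  have pl h : plabels (tmap h U, tmap h D) = map h (labels U ++ labels D).
    by rewrite /plabels /= !labels_tmap map_cat.
  apply: monotone_onto_le (zone_order_incl oF aF fg) _.
    by move=> x xs; have := onto_memE oG (g' x); rewrite pl map_f // => /esym/andP[].
  move=> k x xs /andP[k0 kx].
  have /mapP[y ys ->] : k \in map f' (labels U ++ labels D).
    rewrite -pl onto_memE // k0; apply: leq_trans kx _.
    by apply: le_height; rewrite pl map_f.
  by exists y.
move=> zF zG fg.
have gf : cross_eq g f (labels U) (labels D).
  by move=> x y xU yD; split; rewrite !(fg _ _ xU yD).
have e x : x \in labels U ++ labels D -> f x = g x.
  by move=> xs; apply/eqP; rewrite eqn_leq (le f g) ?(le g f).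
by congr pair; apply: eq_in_tmap => x xs; apply: e; rewrite mem_cat xs ?orbT.
Qed.

End Trees.

(** Two values are merged only along levels of one kind.  If u and d have the same
    image, this image is a barrier, and [merge_barrier] says that no two
    different levels are merged to a barrier. *)
Lemma merge_cross X : onto_interval X ->
  cross_eq (Defs.merge X) id (labels X.1) (labels X.2).
Proof.
move=> oX u d uU dD.
have uP : u \in plabels X by rewrite mem_cat uU.
have dP : d \in plabels X by rewrite mem_cat dD orbT.
have bar i : i = Defs.merge X u -> i = Defs.merge X d -> barrier (proj X) i.
  by move=> eu ed; rewrite /barrier /= !labels_tmap {1}eu ed !map_f.
case: (ltngtP u d) => [lt|lt|->]; last by rewrite !ltnn.
- have le := merge_mono X (ltnW lt).
  have : Defs.merge X u != Defs.merge X d.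
    apply/eqP => e; have := merge_barrier oX (ltnW lt) uP dP e (bar _ erefl e).
    by move=> e'; rewrite e' ltnn in lt.
  by split; apply/idP/idP; lia.
- have le := merge_mono X (ltnW lt).
  have : Defs.merge X u != Defs.merge X d.
    apply/eqP => /esym e.
    have := merge_barrier oX (ltnW lt) dP uP e (bar _ e erefl).
    by move=> e'; rewrite e' ltnn in lt.
  by split; apply/idP/idP; lia.
Qed.

(** * The expression depends only on comparisons between the two trees *)

Lemma nverts_mem (a : nat) s t : t \in s -> nverts t < nverts (Node a s).
Proof. by case/(nthP Leaf) => i lti <-; apply: nverts_child. Qed.

Lemma labels_corolla (a : nat) k : labels (Node a (nseq k Leaf)) = [:: a].
Proof. by rewrite /=; elim: k. Qed.

Lemma labels_top d U : {subset labels (top_part d U) <= labels U}.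
Proof.
elim/ptree_mem_ind: U => // a s IH v /=; case: ifP => // _.
case/labels_NodeP => [->|[_ /mapP[t ts ->] /(IH _ ts) vt]]; first exact: mem_head.
exact: (labels_child a ts).
Qed.

Lemma labels_hanging d U H : H \in hanging d U -> {subset labels H <= labels U}.
Proof.
elim/ptree_mem_ind: U => [|a s IH] /=; first by rewrite inE => /eqP->.
case: ifP => _; last by rewrite inE => /eqP->.
case/flattenP => _ /mapP[t ts ->] /(IH _ ts) sub v /sub vt.
exact: (labels_child a ts).
Qed.

Lemma tmap_top (f : nat -> nat) d d' U :
  {in labels U, forall u, (f u < d') = (u < d)} ->
  top_part d' (tmap f U) = tmap f (top_part d U).
Proof.
elim/ptree_mem_ind: U => // a s IH h /=; rewrite h ?mem_head //.
case: ifP => // _ /=; congr Node; rewrite -!map_comp; apply/eq_in_map => t ts /=.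
by apply: IH => // u ut; apply: h; apply: (labels_child a ts).
Qed.

Lemma tmap_hanging (f : nat -> nat) d d' U :
  {in labels U, forall u, (f u < d') = (u < d)} ->
  hanging d' (tmap f U) = map (tmap f) (hanging d U).
Proof.
elim/ptree_mem_ind: U => // a s IH h /=; rewrite h ?mem_head //.
case: ifP => // _; rewrite map_flatten -!map_comp; congr flatten.
apply/eq_in_map => t ts /=.
by apply: IH => // u ut; apply: h; apply: (labels_child a ts).
Qed.

Lemma eup_tmap f U : eup (tmap f U) = eup U.
Proof.
elim/ptree_mem_ind: U => //= a s IH; rewrite size_map -map_comp.
by congr (EComp _ (ebox _)); apply/eq_in_map.
Qed.

Lemma edown_tmap f D : edown (tmap f D) = edown D.
Proof.
elim/ptree_mem_ind: D => //= a s IH; rewrite size_map -map_comp.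
by congr (EComp (ebox _) _); apply/eq_in_map.
Qed.

Lemma varpi_expr_Leafr U : varpi_expr (U, Leaf) = eup U.
Proof. by rewrite /varpi_expr; case: (_ + _); case: U. Qed.

Lemma varpi_expr_Leafl D : varpi_expr (Leaf, D) = edown D.
Proof. by case: D => //; rewrite varpi_expr_Leafr. Qed.

(** The position of i among the distinct entries of s, counted from 1: the
    relabelling by which [renumber] acts. *)
Definition rank (s : seq nat) (i : nat) : nat :=
  size (undup [seq j <- s | j <= i]).

Lemma renumberE X :
  renumber X = (tmap (rank (plabels X)) X.1, tmap (rank (plabels X)) X.2).
Proof. by []. Qed.

Lemma rank_ltn s i j : j \in s -> i < j -> rank s i < rank s j.
Proof.
move=> js ij; apply: (@uniq_leq_size _ (j :: undup [seq k <- s | k <= i])).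
  by rewrite /= undup_uniq mem_undup mem_filter leqNgt ij.
move=> k; rewrite inE !mem_undup !mem_filter => /orP[/eqP->|/andP[ki ->]].
  by rewrite leqnn.
by rewrite andbT; lia.
Qed.

Lemma rank_cross s P Q : {subset P <= s} -> {subset Q <= s} ->
  cross_eq (rank s) id P Q.
Proof.
move=> Ps Qs i j /Ps iP /Qs jQ.
case: (ltngtP i j) => [ij|ji|->]; last by rewrite !ltnn.
  by have := rank_ltn jQ ij => lt; split; lia.
by have := rank_ltn iP ji => lt; split; lia.
Qed.

Lemma plabels_renumber X :
  plabels (renumber X) = map (rank (plabels X)) (plabels X).
Proof. by rewrite /plabels /= !labels_tmap map_cat. Qed.

(** If t lists the values in increasing order, the k-th entry of t has rank k. *)
Lemma renumber_onto X : onto_interval (renumber X).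
Proof.
apply/andP; split.
  rewrite plabels_renumber; apply/allP => _ /mapP[i iX ->].
  rewrite /rank -has_predT; apply/hasP; exists i => //.
  by rewrite mem_undup mem_filter leqnn.
set s := plabels X; set t := sort leq (undup s).
apply/allP => k; rewrite mem_iota add1n ltnS => /andP[k0 kh].
have h0 : 0 < height (renumber X) by apply: leq_trans kh.
have kt : k.-1 < size t.
  rewrite prednK // size_sort; apply: leq_trans kh _.
  have := height_mem h0; rewrite plabels_renumber => /mapP[i _ ->].
  by rewrite /rank -filter_undup size_filter count_size.
rewrite plabels_renumber; apply/mapP; exists (nth 0 t k.-1).
  by rewrite -/s -mem_undup -(mem_sort leq) mem_nth.
have st : sorted ltn t.
  by rewrite ltn_sorted_uniq_leq sort_uniq undup_uniq sort_sorted //; apply: leq_total.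
rewrite /rank -filter_undup size_filter.
have /seq.permP <- : perm_eq t (undup s) by rewrite perm_sort.
by have := Order.POrderTheory.count_le_nth 0 st kt; rewrite prednK.
Qed.

(** The recursion only compares vertices of U with the root of D, and the trees
    to which it is applied are parts of U and D.  The restrictions renumber their
    labels, but this again preserves comparisons, so the induction hypothesis
    disposes of the renumbering as well. *)
Lemma varpi_expr_cross (f : nat -> nat) (U D : ptree nat) :
  cross_eq f id (labels U) (labels D) ->
  varpi_expr (tmap f U, tmap f D) = varpi_expr (U, D).
Proof.
have [N] := ubnP (nverts U + nverts D).
elim: N f U D => // N IH f [|u Us] [|d Ds] hN fg //.
- by rewrite !varpi_expr_Leafl edown_tmap.
- by rewrite !varpi_expr_Leafr eup_tmap.
have u0 : u \in labels (Node u Us) by apply: mem_head.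
have d0 : d \in labels (Node d Ds) by apply: mem_head.
have topf : {in labels (Node u Us), forall v, (f v < f d) = (v < d)}.
  by move=> v vU; rewrite (fg _ _ vU d0).
rewrite [tmap f (Node u Us)]/= [tmap f (Node d Ds)]/= !varpi_exprE.
rewrite -/(tmap f (Node u Us)) -/(tmap f (Node d Ds)).
rewrite (fg _ _ u0 d0) !size_map.
have [ltE gtE] := fg _ _ u0 d0.
have -> : (f d == f u) = (d == u) by rewrite /= in ltE gtE; apply/idP/idP; lia.
rewrite edown_tmap eup_tmap -!map_comp.
case: ltngtP => ud //; last by
  congr (EComp (ebox _) (EComp _ (ebox _)));
  apply/eq_in_map => t _ /=; rewrite ?edown_tmap ?eup_tmap.
(* By induction, renumbering and relabelling do not affect the expressions of
   the smaller pairs. *)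
have key U' D' : {subset labels U' <= labels (Node u Us)} ->
    {subset labels D' <= labels (Node d Ds)} ->
    nverts U' + nverts D' < nverts (Node u Us) + nverts (Node d Ds) ->
    varpi_expr (renumber (tmap f U', tmap f D')) =
    varpi_expr (renumber (U', D')).
  move=> sU sD lt; have ltN : nverts U' + nverts D' < N by lia.
  have E (g : nat -> nat) : cross_eq g id (labels U') (labels D') ->
      varpi_expr (renumber (tmap g U', tmap g D')) = varpi_expr (U', D').
    move=> gU; rewrite renumberE /= IH ?nverts_tmap //.
      by rewrite (IH g).
    by apply: rank_cross => v vs; rewrite mem_cat vs ?orbT.
  rewrite (E f); last exact: cross_eq_sub sU sD fg.
  by rewrite -(E id) // !tmap_id.
rewrite (tmap_top topf) (tmap_hanging topf) -map_comp; congr fraction.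
  apply/eq_in_map => t tD.
  apply: key => //; first exact: labels_top.
    exact: labels_child.
  by rewrite -addnS leq_add ?nverts_top ?nverts_mem.
apply/eq_in_map => t tH /=.
have -> : Node (f d) (nseq (size Ds) Leaf) = tmap f (Node d (nseq (size Ds) Leaf)).
  by rewrite /= map_nseq.
apply: key.
- exact: labels_hanging tH.
- by move=> v; rewrite labels_corolla inE => /eqP->.
- rewrite nverts_corolla -addSn leq_add //.
  exact: (allP (nverts_hanging_lt Us ud)).
Qed.

Lemma varpi_expr_proj X : onto_interval X -> varpi_expr (proj X) = varpi_expr X.
Proof. by case: X => U D oX; apply/varpi_expr_cross/(merge_cross oX). Qed.

(** * Every zone function comes from a level function *)

Fixpoint with_depth (A : Type) (k : nat) (T : ptree A) : ptree (A * nat) :=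
  if T is Node a s then Node (a, k) (map (with_depth k.+1) s) else Leaf.

Lemma tmap_with_depth (A : eqType) k (T : ptree A) : tmap fst (with_depth k T) = T.
Proof.
elim/ptree_mem_ind: T k => //= a s IH k; congr Node.
by rewrite -map_comp -[RHS]map_id; apply/eq_in_map => t ts; apply: IH.
Qed.

Lemma with_depth_bounds (A : eqType) k (T : ptree A) p :
  p \in labels (with_depth k T) -> k <= p.2 < k + nverts T.
Proof.
elim/ptree_mem_ind: T k => //= a s IH k.
have nvE : nverts (Node a s) = (sumn (map (@nverts A) s)).+1.
  by rewrite /nverts /= size_flatten /shape -map_comp.
case/labels_NodeP => [->|[_ /mapP[t ts ->] /(IH t ts) /andP[h1 h2]]].
  by rewrite /= leqnn nvE addnS ltnS leq_addr.
rewrite nvE (ltnW h1) addnS ltnS; move: h2; rewrite addSn => h2.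
have : nverts t <= sumn (map (@nverts A) s).
  case/(nthP Leaf): ts => i lti <-.
  by rewrite -(nth_map _ 0 (@nverts A)) //; apply: leq_sumn_nth.
lia.
Qed.

Lemma desc_with_depth (A : eqType) k (T : ptree A) :
  desc (fun p q => p.2 < q.2) (with_depth k T).
Proof.
elim/ptree_mem_ind: T k => //= a s IH k; rewrite all_map.
apply/allP => t ts /=; rewrite IH // andbT.
by apply/allP => p /with_depth_bounds /andP[].
Qed.

Lemma descI A (r r' : rel A) T :
  desc r T -> desc r' T -> desc (fun x y => r x y && r' x y) T.
Proof.
elim/ptree_ind': T => //= a s IH /all_nth_ptree h /all_nth_ptree h'.
apply/all_nth_ptree => i lti.
have /andP[h1 h2] := h i lti; have /andP[h3 h4] := h' i lti.
by rewrite IH // andbT all_predI h1.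
Qed.

(** Inside an up-zone, levels are ordered by the depth in U; inside a down-zone, by
    the opposite of the depth in D, because the root of D is at the bottom; the
    vertices of a barrier stay on one level.  This refines the zone function
    without touching the comparisons between U and D, so [zone_unique] identifies
    the projection without computing it. *)
Lemma proj_onto n m Z : is_zone n m Z ->
  exists2 X, is_level n m X & proj X = Z.
Proof.
case: Z => U D zZ; pose Z := (U, D).
(* M exceeds every depth, so that z * M + depth sorts by z first. *)
pose M := nverts U + nverts D.
pose AU := with_depth 0 U; pose AD := with_depth 0 D.
pose keyU (p : nat * nat) := p.1 * M + (if barrier Z p.1 then 0 else p.2).
pose keyD (p : nat * nat) :=
  p.1 * M + (if barrier Z p.1 then 0 else M.-1 - p.2).
pose KU := tmap (fun p => (p.1, keyU p)) AU.
pose KD := tmap (fun p => (p.1, keyD p)) AD.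
have EU : tmap fst KU = U by rewrite tmap_comp -[RHS](tmap_with_depth 0).
have ED : tmap fst KD = D by rewrite tmap_comp -[RHS](tmap_with_depth 0).
pose L := (tmap snd KU, tmap snd KD); pose X := renumber L.
have lU p : p \in labels AU -> p.2 < M.
  by move=> /with_depth_bounds/andP[_ lt]; apply: leq_trans lt (leq_addr _ _).
have lD p : p \in labels AD -> p.2 < M.
  by move=> /with_depth_bounds/andP[_ lt]; apply: leq_trans lt (leq_addl _ _).
have [/and4P[pU pD lvU lvD] _ dU dD /and3P[bU bD _]] := and5P zZ.
have key_lt a b x y : a < b -> x < M -> a * M + x < b * M + y.
  move=> ab xM; apply: (@leq_trans (a.+1 * M)); first by rewrite mulSnr ltn_add2l.
  by apply: leq_trans (leq_addr _ _); rewrite leq_mul2r ab orbT.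
have labU : labels (tmap snd KU) = map keyU (labels AU).
  by rewrite tmap_comp labels_tmap.
have labD : labels (tmap snd KD) = map keyD (labels AD).
  by rewrite tmap_comp labels_tmap.
have memU p : p \in labels AU -> keyU p \in plabels L.
  by move=> pA; rewrite mem_cat labU map_f.
have memD p : p \in labels AD -> keyD p \in plabels L.
  by move=> pA; rewrite mem_cat labD map_f ?orbT.
have offU p : p \in labels AU -> (if barrier Z p.1 then 0 else p.2) < M.
  by move=> /lU lt; case: ifP => _ //; apply: leq_ltn_trans lt.
have offD p : p \in labels AD -> (if barrier Z p.1 then 0 else M.-1 - p.2) < M.
  move=> /lD lt; case: ifP => _; first exact: leq_ltn_trans lt.
  by apply: leq_ltn_trans (leq_subr _ _) _; rewrite ltn_predL; apply: leq_ltn_trans lt.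
have levX : is_level n m X.
  apply/and4P; split.
  - rewrite /trees_ok /= !planar_tmap !leaves_tmap.
    rewrite -(planar_tmap fst) -(planar_tmap fst AD) -(leaves_tmap fst).
    by rewrite -(leaves_tmap fst AD) !tmap_with_depth; apply/and4P.
  - exact: renumber_onto.
  - rewrite /X /= !desc_tmap.
    have d1 : desc (fun p q => p.1 <= q.1) AU.
      by rewrite -(desc_tmap fst leq) tmap_with_depth.
    have d2 : desc (fun p q => ~~ ((p.1 == q.1) && barrier Z p.1)) AU.
      by rewrite -(desc_tmap fst (fun i j => ~~ ((i == j) && barrier Z i))) tmap_with_depth.
    apply: desc_sub (descI (desc_with_depth 0 U) (descI d1 d2)) => p q pA qA.
    case/and3P => lt2; rewrite leq_eqVlt => /orP[/eqP e1|lt1] nb; apply: rank_ltn.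
    + exact: memU.
    + by move: nb; rewrite e1 eqxx /= /keyU e1 => /negbTE->; rewrite ltn_add2l.
    + exact: memU.
    + exact: key_lt lt1 (offU _ pA).
  - rewrite /X /= !desc_tmap.
    have d1 : desc (fun p q => p.1 >= q.1) AD.
      by rewrite -(desc_tmap fst geq) tmap_with_depth.
    have d2 : desc (fun p q => ~~ ((p.1 == q.1) && barrier Z p.1)) AD.
      by rewrite -(desc_tmap fst (fun i j => ~~ ((i == j) && barrier Z i))) tmap_with_depth.
    apply: desc_sub (descI (desc_with_depth 0 D) (descI d1 d2)) => p q pA qA.
    case/and3P => lt2; rewrite leq_eqVlt => /orP[/eqP e1|lt1] nb; apply: rank_ltn.
    + exact: memD.
    + move: nb; rewrite e1 eqxx /= /keyD e1 => /negbTE->; rewrite ltn_add2l /=.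
      have qM := lD _ qA; apply: (ltn_sub2l _ lt2); apply: leq_trans lt2 _.
      by rewrite -ltnS prednK // (leq_ltn_trans _ qM).
    + exact: memD.
    + exact: key_lt lt1 (offD _ qA).
exists X => //.
pose lev (p : nat * nat) := Defs.merge X (rank (plabels L) p.2).
have EX : proj X = (tmap lev KU, tmap lev KD).
  by rewrite /proj {2 4}/X renumberE /= !tmap_comp.
suff : (tmap lev KU, tmap lev KD) = (tmap fst KU, tmap fst KD).
  by rewrite EX EU ED.
apply: (@zone_unique _ n m).
- by rewrite -EX; apply: proj_zone.
- by rewrite EU ED.
move=> x y; rewrite !labels_tmap => /mapP[p pA ->] /mapP[q qA ->].
have pX : rank (plabels L) (keyU p) \in labels X.1.
  by rewrite /X /= labels_tmap labU !map_f.
have qX : rank (plabels L) (keyD q) \in labels X.2.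
  by rewrite /X /= labels_tmap labD !map_f.
have oX : onto_interval X by case/and4P: levX.
have [sU sD] : {subset [:: keyU p] <= plabels L} /\ {subset [:: keyD q] <= plabels L}.
  by split=> i; rewrite inE => /eqP->; [apply: memU | apply: memD].
have rC := rank_cross sU sD (mem_head _ _) (mem_head _ _).
rewrite /lev /= !(merge_cross oX pX qX) /= !rC /= /keyU /keyD.
have pU1 : p.1 \in labels U by rewrite -(tmap_with_depth 0 U) labels_tmap map_f.
have qD1 : q.1 \in labels D by rewrite -(tmap_with_depth 0 D) labels_tmap map_f.
case: (ltngtP p.1 q.1) => [lt|lt|e].
- have k := key_lt _ _ _ (if barrier Z q.1 then 0 else M.-1 - q.2) lt (offU _ pA).
  by rewrite k ltnNge (ltnW k).
- have k := key_lt _ _ _ (if barrier Z p.1 then 0 else p.2) lt (offD _ qA).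
  by rewrite k ltnNge (ltnW k).
by rewrite e in pU1 *; rewrite /barrier /= pU1 qD1 !ltnn.
Qed.

(** * Words along paths: an invariant of the free PROP *)

(** [((m, i), (n, j))] records the passage through an operation with m inputs and
    n outputs from its i-th input to its j-th output. *)
Definition letter : Type := ((nat * nat) * (nat * nat))%type.

(** The words are read from the output j to the input i, in the order in which
    vertical compositions are written.  The set of all words is needed here: in
    a general expression there may be several paths from i to j. *)
Fixpoint path_word (t : expr) (j i : nat) (w : seq letter) : Prop :=
  match t with
  | EUnit => [/\ j = 0, i = 0 & w = [::]]
  | EGen n m => [/\ j < n, i < m & w = [:: ((m, i), (n, j))]]
  | EComp x y => exists k w1 w2,
      [/\ path_word x j k w1, path_word y k i w2 & w = w1 ++ w2]
  | EBox x y => path_word x j i w \/ exists j' i',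
      [/\ j = outs x + j', i = inps x + i' & path_word y j' i' w]
  | EActl n s x => exists2 k : 'I_n, j = s k & path_word x k i w
  | EActr x m s => exists2 k : 'I_m, i = k & path_word x j (s k) w
  end.

Lemma path_word_bounds t j i w :
  wt t -> path_word t j i w -> j < outs t /\ i < inps t.
Proof.
elim: t j i w => /= [|n m|x IHx y IHy|x IHx y IHy|n s x IHx|x IHx m s] j i w.
- by move=> _ [-> ->].
- by move=> _ [].
- case/and3P => wx wy _ [k [w1 [w2 [/(IHx _ _ _ wx)[? _] /(IHy _ _ _ wy)[_ ?] _]]]].
  by [].
- case/andP => wx wy [/(IHx _ _ _ wx)[h1 h2]|[j' [i' [-> -> /(IHy _ _ _ wy)[h1 h2]]]]].
    by split; apply: ltn_addr.
  by rewrite !ltn_add2l.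
- by case/andP => wx _ [k -> /(IHx _ _ _ wx)[]].
- by case/andP => wx _ [k -> /(IHx _ _ _ wx)[]].
Qed.

Lemma path_word_eunits n j i w :
  path_word (eunits n) j i w <-> [/\ j = i, j < n.+1 & w = [::]].
Proof.
elim: n j i w => [|n IH] j i w /=.
  by split=> [[-> -> ->]|[-> /[!ltnS]/[!leqn0]/eqP-> ->]].
split=> [[[-> -> ->]|[j' [i' [-> -> /IH[-> h ->]]]]]|[-> h ->]] //.
case: i h => [|i] h; [by left | right; exists i, i; split=> //; exact/IH].
Qed.

Lemma swap_permE n1 n2 (k : 'I_(n1 + n2)) :
  swap_perm n1 n2 k = (if k < n1 then n2 + k else k - n1) :> nat.
Proof.
by rewrite permE /swap_fun /=; case: fintype.splitP => l e /=; rewrite e ?addKn.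
Qed.

Lemma block_permE n1 n2 (s : 'S_n1) (t : 'S_n2) (k : 'I_(n1 + n2)) :
  block_perm s t k = (match fintype.split k with
     | inl l => s l : nat | inr l => n1 + t l end) :> nat.
Proof. by rewrite permE /block_fun; case: fintype.split. Qed.

Lemma block_perm_lshift n1 n2 (s : 'S_n1) (t : 'S_n2) (k : 'I_n1) :
  block_perm s t (lshift n2 k) = s k :> nat.
Proof. by rewrite block_permE (unsplitK (inl k)). Qed.

Lemma block_perm_rshift n1 n2 (s : 'S_n1) (t : 'S_n2) (k : 'I_n2) :
  block_perm s t (rshift n1 k) = n1 + t k :> nat.
Proof. by rewrite block_permE (unsplitK (inr k)). Qed.

(** These are the axioms of a PROP for matrices of languages.  Well-typedness gives
    the bounds on ports without which the units and the block sums would not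
    match. *)
Lemma path_word_axiom t u : prop_axiom t u -> wt t -> wt u ->
  forall j i w, path_word t j i w <-> path_word u j i w.
Proof.
case=> /=.
- move=> n x /andP[wx /eqP ex] _ j i w; split=> [[k -> p]|p].
    by rewrite perm1.
  have [lt _] := path_word_bounds wx p; rewrite ex in lt.
  by exists (Ordinal lt); rewrite ?perm1.
- move=> n s t' x _ _ j i w; split=> [[k -> p]|[k -> [l e p]]].
    by exists (s k); [rewrite permM | exists k].
  by exists l => //; rewrite permM; congr (_ (t' _)); apply: val_inj.
- move=> m x /andP[wx /eqP ex] _ j i w; split=> [[k -> p]|p].
    by rewrite perm1 in p.
  have [_ lt] := path_word_bounds wx p; rewrite ex in lt.
  by exists (Ordinal lt); rewrite ?perm1.
- move=> m s t' x _ _ j i w; split=> [[k -> p]|[k -> [l e p]]].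
    by exists k => //; exists (s k) => //; rewrite -permM.
  by exists k => //; rewrite permM (val_inj e : s k = l).
- move=> n m s t' x _ _ j i w.
  by split=> [[k -> [l -> p]]|[l -> [k -> p]]]; [exists l|exists k] => //; [exists k|exists l].
- move=> x y z _ _ j i w.
  split=> [[k [w1 [w2 [[l [w3 [w4 [px py ->]]]] pz ->]]]]|[k [w1 [w2 [px [l [w3 [w4 [py pz ->]]]] ->]]]]].
    by exists l, w3, (w4 ++ w2); rewrite catA; split=> //; exists k, w4, w2.
  by exists l, (w1 ++ w3), w4; rewrite catA; split=> //; exists k, w1, w3.
- move=> n x /and3P[_ wx /eqP ex] _ j i w.
  have /and3P[_ _ /eqP e'] := units_biarity n.
  split=> [[k [w1 [w2 [/path_word_eunits[-> _ ->] p ->]]]] //|p].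
  have [lt _] := path_word_bounds wx p; rewrite ex e' in lt.
  by exists j, [::], w; split=> //; apply/path_word_eunits.
- move=> n x /and3P[wx _ /eqP ex] _ j i w.
  have /and3P[_ /eqP e' _] := units_biarity n.
  split=> [[k [w1 [w2 [p /path_word_eunits[<- _ ->] ->]]]]|p]; first by rewrite cats0.
  have [_ lt] := path_word_bounds wx p; rewrite -ex e' in lt.
  by exists i, w, [::]; rewrite cats0; split=> //; apply/path_word_eunits.
- move=> n s x y _ _ j i w.
  split=> [[k [w1 [w2 [[l -> px] py ->]]]]|[l -> [k [w1 [w2 [px py ->]]]]]].
    by exists l => //; exists k, w1, w2.
  by exists k, w1, w2; split=> //; exists l.
- move=> n s x y _ _ j i w.
  split=> [[k [w1 [w2 [px [l -> py] ->]]]]|[l -> [k [w1 [w2 [px py ->]]]]]].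
    by exists l => //; exists k, w1, w2.
  by exists k, w1, w2; split=> //; exists l.
- move=> n s x y _ _ j i w.
  split=> [[k [w1 [w2 [[l -> px] py ->]]]]|[k [w1 [w2 [px [l ek py] ->]]]]].
    by exists (s l), w1, w2; split=> //; exists l.
  by exists l, w1, w2; split=> //; exists l; rewrite -?ek.
- move=> x y z _ _ j i w; split.
    case=> [p|[j' [i' [-> -> [p|[j2 [i2 [-> -> p]]]]]]]]; first by left; left.
      by left; right; exists j', i'.
    by right; exists j2, i2; rewrite !addnA.
  case=> [[p|[j' [i' [-> -> p]]]]|[j2 [i2 [-> -> p]]]]; first by left.
    by right; exists j', i'; split=> //; left.
  right; exists (outs y + j2), (inps y + i2); rewrite !addnA; split=> //.
  by right; exists j2, i2.
- move=> x y /andP[/andP[wx wy] _] _ j i w; split.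
    case=> k -> [p|[j' [i' [ek -> p]]]].
      have [ltj lti] := path_word_bounds wx p.
      exists (Ordinal (ltn_addr (inps y) lti)) => //; right.
      by exists k, i; rewrite !swap_permE /= ltj lti.
    have [ltj lti] := path_word_bounds wy p.
    have lti' : inps x + i' < inps x + inps y by rewrite ltn_add2l.
    exists (Ordinal lti') => //; left; rewrite !swap_permE ek /=.
    by rewrite !ltnNge !leq_addr /= !addKn.
  case=> k -> [p|[j' [i' [-> ek p]]]].
    have [ltj lti] := path_word_bounds wy p; move: lti p.
    rewrite swap_permE; case: (ltnP k (inps x)) => hk; first by lia.
    move=> lti p; have ltj' : outs x + j < outs x + outs y by rewrite ltn_add2l.
    exists (Ordinal ltj').
      by rewrite swap_permE /= ltnNge leq_addr addKn.
    by right; exists j, (k - inps x); rewrite subnKC.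
  have [ltj lti] := path_word_bounds wx p; move: ek.
  rewrite swap_permE; case: (ltnP k (inps x)) => hk ek; last by have := ltn_ord k; lia.
  exists (Ordinal (ltn_addr (outs y) ltj)).
    by rewrite swap_permE /= ltj.
  by left; move: p; rewrite (addnI ek).
- move=> n1 n2 s t' x y /andP[/andP[wx /eqP ex] /andP[wy /eqP ey]] _ j i w; split.
    case=> [[k -> p]|[j' [i' [-> -> [k -> p]]]]].
      by exists (lshift n2 k); [rewrite block_perm_lshift | left].
    exists (rshift n1 k); first by rewrite block_perm_rshift.
    by right; exists k, i'; rewrite ex.
  case=> k -> [p|[j' [i' [ek -> p]]]].
    have [lt _] := path_word_bounds wx p; rewrite ex in lt; left.
    exists (Ordinal lt) => //; rewrite -(block_perm_lshift s t').
    have e : k = lshift n2 (Ordinal lt) by apply: val_inj.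
    by rewrite {1}e.
  have [lt _] := path_word_bounds wy p; rewrite ey in lt; right.
  exists (t' (Ordinal lt)), i'; split=> //; last by exists (Ordinal lt).
  rewrite -(block_perm_rshift s t').
  have e : k = rshift n1 (Ordinal lt) by apply: val_inj; rewrite /= ek ex.
  by rewrite {1}e.
- move=> n1 n2 s t' x y /andP[/andP[wx /eqP ex] /andP[wy /eqP ey]] _ j i w; split.
    case=> [[k -> p]|[j' [i' [-> -> [k -> p]]]]].
      by exists (lshift n2 k) => //; left; rewrite block_perm_lshift.
    exists (rshift n1 k) => //.
    by right; exists j', (t' k); rewrite block_perm_rshift ex.
  case=> k ->; rewrite block_permE; case: fintype.splitP => l ek.
    case=> [p|[j' [i' [-> e p]]]]; first by left; exists l.
    by have := ltn_ord (s l); rewrite e ex; lia.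
  case=> [p|[j' [i' [-> e p]]]].
    by have [_] := path_word_bounds wx p; lia.
  right; exists j', l; split=> //; exists l => //.
  by move: e p; rewrite ex => /addnI->.
- move=> x1 y1 x2 y2 _ /andP[/and3P[w1 w2 /eqP e1] /and3P[w3 w4 /eqP e2]] j i w; split.
    case=> [k [v1 [v2 [[px|[j' [k' [-> ek px]]]] [py|[k2 [i' [ek2 -> py]]]] ->]]]].
    + by left; exists k, v1, v2.
    + by have [_] := path_word_bounds w1 px; lia.
    + by have [+ _] := path_word_bounds w2 py; lia.
    right; exists j', i'; split=> //; exists k', v1, v2; split=> //.
    by move: ek py; rewrite ek2 e1 => /addnI->.
  case=> [[k [v1 [v2 [px py ->]]]]|[j' [i' [-> -> [k [v1 [v2 [px py ->]]]]]]]].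
    by exists k, v1, v2; split=> //; left.
  exists (inps x1 + k), v1, v2; split=> //; right.
    by exists j', k.
  by exists k, i'; rewrite e1.
Qed.

Lemma path_word_peq t u : peq t u ->
  forall j i w, path_word t j i w <-> path_word u j i w.
Proof.
elim=> {t u} [t u a wt wu|//|x y _ IH|x y z _ IH1 _ IH2|x x' y y' _ IHx _ IHy _
  |x x' y y' pq IHx _ IHy|n s x x' _ IH _|n s x x' _ IH _] j i w /=.
- exact: path_word_axiom.
- by rewrite IH.
- by rewrite IH1 IH2.
- by split=> [] [k [w1 [w2 [/IHx px /IHy py ->]]]]; exists k, w1, w2.
- have [_ _ eo ei] := peq_wt pq.
  by split=> [] [/IHx p|[j' [i' [-> -> /IHy p]]]]; try (by left); right; exists j', i';
     rewrite ?eo ?ei.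
- by split=> [] [k -> /IH p]; exists k.
- by split=> [] [k -> /IH p]; exists k.
Qed.

Lemma flatten_index_const sh r c k : r <= size sh ->
  {in sh, forall x, x = k} -> flatten_index sh r c = r * k + c.
Proof.
move=> rs shk; rewrite /flatten_index; congr addn.
suff -> : take r sh = nseq r k by rewrite sumn_nseq mulnC.
apply: (@eq_from_nth _ 0) => [|q]; rewrite size_takel ?size_nseq // => qr.
by rewrite nth_take // nth_nseq qr; apply/shk/mem_nth/(leq_trans qr).
Qed.

Lemma path_word_ebox s j i w : 0 < size s ->
  path_word (ebox s) j i w <-> exists r j' i',
    [/\ r < size s, j = flatten_index (map outs s) r j',
        i = flatten_index (map inps s) r i' & path_word (nth EUnit s r) j' i' w].
Proof.
elim: s j i => // x [|y s] IH j i _.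
  split=> [p|[[|r] [j' [i' [//]]]]]; first by exists 0, j, i.
  by rewrite /flatten_index /= !add0n => _ -> ->.
rewrite ebox_cons; split.
  case=> [p|[j' [i' [-> -> /IH]]]]; first by exists 0, j, i.
  move=> /(_ isT)[r [j2 [i2 [rs -> -> p]]]]; exists r.+1, j2, i2.
  by split=> //; rewrite /flatten_index /= addnA.
case=> [[|r] [j' [i' [rs -> -> p]]]]; first by left.
right; exists (flatten_index (map outs (y :: s)) r j').
exists (flatten_index (map inps (y :: s)) r i').
by rewrite /flatten_index /= !addnA; split=> //; apply/IH => //; exists r, j', i'.
Qed.

(** The permutation of the fraction leads the s-th input of the t-th numerator to
    the t-th output of the s-th denominator. *)
Lemma path_word_fraction Bs As j i w : 0 < size Bs -> 0 < size As ->
  {in Bs, forall b, wt b /\ inps b = size As} ->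
  {in As, forall a, wt a /\ outs a = size Bs} ->
  path_word (fraction Bs As) j i w <-> exists t s j' i' w1 w2,
    [/\ [/\ t < size Bs & s < size As],
        j = flatten_index (map outs Bs) t j',
        i = flatten_index (map inps As) s i' &
        [/\ path_word (nth EUnit Bs t) j' s w1, path_word (nth EUnit As s) t i' w2
          & w = w1 ++ w2]].
Proof.
set k := size Bs; set l := size As => k0 l0 hB hA.
have fB t c : t < k -> flatten_index (map inps Bs) t c = t * l + c.
  move=> tk; apply: flatten_index_const; first by rewrite size_map ltnW.
  by move=> _ /mapP[b /hB[_ e] ->].
have fA s c : s < l -> flatten_index (map outs As) s c = s * k + c.
  move=> sl; apply: flatten_index_const; first by rewrite size_map ltnW.
  by move=> _ /mapP[a /hA[_ e] ->].
have frE s t (lt : s * k + t < l * k) : t < k -> s < l ->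
    frac_perm l k (Ordinal lt) = t * l + s :> nat.
  move=> tk sl; rewrite permE /= modnMDl modn_small // divnMDl //.
  by rewrite divn_small // addn0.
split.
- case=> c [w1 [w2 [/path_word_ebox -/(_ k0)[t [j' [s [tk -> -> p1]]]]]]].
  case=> q; rewrite fB // => eq /path_word_ebox -/(_ l0)[s' [t' [i' [sl eq' -> p2]]]] ->.
  have [wb eb] := hB _ (mem_nth EUnit tk); have [wa ea] := hA _ (mem_nth EUnit sl).
  have [_] := path_word_bounds wb p1; rewrite eb => sl'.
  have [tk' _] := path_word_bounds wa p2; rewrite ea in tk'.
  rewrite fA // in eq'; have lt : s' * k + t' < l * k by rewrite -eq'.
  have eql : q = Ordinal lt by apply: val_inj.
  rewrite eql frE // in eq.
  have et : t = t' by have := congr1 (divn^~ l) eq; rewrite !divnMDl // !divn_small // !addn0.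
  have es : s = s'.
    by move: eq; rewrite et => /addnI.
  by subst t' s'; exists t, s, j', i', w1, w2.
case=> t [s [j' [i' [w1 [w2 [[tk sl] -> -> [p1 p2 ->]]]]]]].
have lt : s * k + t < l * k.
  by apply: (@leq_trans (s.+1 * k)); rewrite ?mulSnr ?ltn_add2l // -mulSnr leq_mul2r sl orbT.
exists (t * l + s), w1, w2; split=> //.
  by apply/path_word_ebox => //; exists t, j', s; rewrite fB.
exists (Ordinal lt); first by rewrite frE.
by apply/path_word_ebox => //; exists s, t, i'; rewrite fA.
Qed.

(** * Branches of trees *)

(** The vertices from the root to the i-th leaf, each with its label, its arity and
    the position of the child through which the branch continues.  It is a
    relation so as to match the shape of [path_word]. *)
Fixpoint branch (A : Type) (T : ptree A) (i : nat) (p : seq (A * (nat * nat))) :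
    Prop :=
  if T is Node a s then
    exists r i' p', [/\ r < size s, i = flatten_index (map (@leaves A) s) r i',
      p = (a, (size s, r)) :: p' & nth (fun _ _ => False) (map (@branch A) s) r i' p']
  else i = 0 /\ p = [::].

Lemma branch_NodeP A (a : A) s i p :
  branch (Node a s) i p <-> exists r i' p',
    [/\ r < size s, i = flatten_index (map (@leaves A) s) r i',
        p = (a, (size s, r)) :: p' & branch (nth Leaf s r) i' p'].
Proof.
by split=> -[r [i' [p' [rs -> -> h]]]]; exists r, i', p'; split=> //;
   move: h; rewrite (nth_map Leaf).
Qed.

(** A vertex of U that meets only an edge of D is the operation xi^1_a. *)
Definition up_letter (x : nat * (nat * nat)) : letter := (x.2, (1, 0)).
Definition down_letter (x : nat * (nat * nat)) : letter := ((1, 0), x.2).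

(** The merge of two branches that are sorted by level; [(x.2, y.2)] is the letter of
    a vertex of U and a vertex of D that meet in one operation.  It uses only
    comparisons between the two lists. *)
Fixpoint interleave (p q : seq (nat * (nat * nat))) {struct p} : seq letter :=
  (fix mg q := match p, q with
   | [::], _ => map down_letter q
   | _, [::] => map up_letter p
   | x :: p', y :: q' =>
     if x.1 < y.1 then up_letter x :: interleave p' q
     else if y.1 < x.1 then down_letter y :: mg q'
     else (x.2, y.2) :: interleave p' q'
   end) q.

Lemma interleavel0 q : interleave [::] q = map down_letter q.
Proof. by case: q. Qed.

Lemma interleaver0 p : interleave p [::] = map up_letter p.
Proof. by case: p. Qed.

Lemma interleave_cons x p y q : interleave (x :: p) (y :: q) =
  if x.1 < y.1 then up_letter x :: interleave p (y :: q)
  else if y.1 < x.1 then down_letter y :: interleave (x :: p) q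
  else (x.2, y.2) :: interleave p q.
Proof. by []. Qed.

(** A horizontal cut at level d, as the vertical compositions in the definition of
    varpi require. *)
Lemma interleave_cat d p1 p2 q1 q2 :
  all (fun x => x.1 < d) p1 -> all (fun x => x.1 < d) q1 ->
  all (fun x => d <= x.1) p2 -> all (fun x => d <= x.1) q2 ->
  interleave (p1 ++ p2) (q1 ++ q2) = interleave p1 q1 ++ interleave p2 q2.
Proof.
move=> h1 h2 h3 h4.
elim: p1 q1 h1 h2 => [|x p1 IHp].
  elim=> [|y q1 IHq] _ hq //.
  case: p2 h3 IHq => [|z p2] h3 IHq; first by rewrite !interleavel0 -map_cat.
  have /andP[yd hq1] := hq; have /andP[zd _] := h3.
  rewrite cat_cons interleave_cons ltnNge (ltnW (leq_trans yd zd)) (leq_trans yd zd).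
  by rewrite IHq // !interleavel0.
elim=> [|y q1 IHq] hp hq; have /andP[xd hp1] := hp.
  have := IHp [::] hp1 isT; rewrite cat0s interleaver0 => e.
  rewrite interleaver0 /= -e; case: q2 h4 {IHp e} => [|z q2] /=; first by rewrite !interleaver0.
  by case/andP => zd _; rewrite (leq_trans xd zd).
have /andP[yd hq1] := hq; rewrite !cat_cons !interleave_cons.
case: ifP => _; first by rewrite -cat_cons IHp.
case: ifP => _; first by rewrite -[x :: _ ++ _]cat_cons IHq.
by rewrite IHp.
Qed.

(** * The words of varpi *)

Definition eup_spec U : Prop := forall j i w,
  path_word (eup U) j i w <->
  j = 0 /\ exists2 p, branch U i p & w = map up_letter p.

(** The branch is reversed because words are read from the outputs, where the
    leaves of D are, down to its root. *)
Definition edown_spec D : Prop := forall j i w,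
  path_word (edown D) j i w <->
  i = 0 /\ exists2 q, branch D j q & w = map down_letter (rev q).

(** Assuming the description for the single trees makes this usable both inside the
    induction that proves it and afterwards. *)
Lemma path_word_ebox_eup s r i w : 0 < size s -> all (@planar nat) s ->
  {in s, forall t, eup_spec t} ->
  path_word (ebox (map eup s)) r i w <-> exists i' p,
    [/\ r < size s, i = flatten_index (map (@leaves nat) s) r i',
        branch (nth Leaf s r) i' p & w = map up_letter p].
Proof.
move=> s0 /allP hs IH; have s0' : 0 < size (map eup s) by rewrite size_map.
have fo q c : q < size s -> flatten_index (map outs (map eup s)) q c = q + c.
  move=> qs; rewrite (@flatten_index_const _ _ _ 1) ?muln1 // ?size_map ?(ltnW qs) //.
  move=> _ /mapP[_ /mapP[t /hs pt ->] ->].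
  by have /and3P[_ /eqP] := eup_biarity pt.
have fi : map inps (map eup s) = map (@leaves nat) s.
  rewrite -map_comp; apply/eq_in_map => t /hs pt /=.
  by have /and3P[_ _ /eqP] := eup_biarity pt.
rewrite path_word_ebox // fi size_map; split.
  case=> q [j' [i' [qs -> -> +]]]; rewrite (nth_map Leaf) // fo //.
  case/(IH _ (mem_nth _ qs)) => -> [p tp ->].
  by rewrite addn0; exists i', p.
case=> i' [p [rs -> tp ->]]; exists r, 0, i'; rewrite fo // addn0; split=> //.
by rewrite (nth_map Leaf) //; apply/IH; [apply: mem_nth | split=> //; exists p].
Qed.

Lemma path_word_ebox_edown s j r w : 0 < size s -> all (@planar nat) s ->
  {in s, forall t, edown_spec t} ->
  path_word (ebox (map edown s)) j r w <-> exists j' q,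
    [/\ r < size s, j = flatten_index (map (@leaves nat) s) r j',
        branch (nth Leaf s r) j' q & w = map down_letter (rev q)].
Proof.
move=> s0 /allP hs IH; have s0' : 0 < size (map edown s) by rewrite size_map.
have fi q c : q < size s -> flatten_index (map inps (map edown s)) q c = q + c.
  move=> qs; rewrite (@flatten_index_const _ _ _ 1) ?muln1 // ?size_map ?(ltnW qs) //.
  move=> _ /mapP[_ /mapP[t /hs pt ->] ->].
  by have /and3P[_ _ /eqP] := edown_biarity pt.
have fo : map outs (map edown s) = map (@leaves nat) s.
  rewrite -map_comp; apply/eq_in_map => t /hs pt /=.
  by have /and3P[_ /eqP] := edown_biarity pt.
rewrite path_word_ebox // fo size_map; split.
  case=> q [j' [i' [qs -> -> +]]]; rewrite (nth_map Leaf) // fi //.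
  case/(IH _ (mem_nth _ qs)) => -> [p tp ->].
  by rewrite addn0; exists j', p.
case=> j' [p [rs -> tp ->]]; exists r, j', 0; rewrite fi // addn0; split=> //.
by rewrite (nth_map Leaf) //; apply/IH; [apply: mem_nth | split=> //; exists p].
Qed.

Lemma path_word_eup U : planar U -> eup_spec U.
Proof.
elim/ptree_mem_ind: U => [|a s IH].
  move=> _ j i w; split=> [[-> -> ->]|[-> [p [-> ->] ->]]] //.
  by split=> //; exists [::].
move=> /= /andP[s1 hs] j i w; have s0 : 0 < size s by apply: ltnW.
have {}IH : {in s, forall t, eup_spec t} by move=> t ts; apply/IH/(allP hs).
split.
  case=> k [w1 [w2 [[j1 _ ->] /(path_word_ebox_eup _ _ _ s0 hs IH) + ->]]].
  case=> i' [p [ks -> tp ->]]; have j0 : j = 0 by case: j j1.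
  split=> //; exists ((a, (size s, k)) :: p); last by rewrite j0.
  by apply/branch_NodeP; exists k, i', p.
case=> -> [_ /branch_NodeP[r [i' [p [rs -> -> tp]]]] ->].
exists r, [:: up_letter (a, (size s, r))], (map up_letter p); split=> //.
by apply/path_word_ebox_eup => //; exists i', p.
Qed.

Lemma path_word_edown D : planar D -> edown_spec D.
Proof.
elim/ptree_mem_ind: D => [|a s IH].
  move=> _ j i w; split=> [[-> -> ->]|[-> [p [-> ->] ->]]] //.
  by split=> //; exists [::].
move=> /= /andP[s1 hs] j i w; have s0 : 0 < size s by apply: ltnW.
have {}IH : {in s, forall t, edown_spec t} by move=> t ts; apply/IH/(allP hs).
split.
  case=> k [w1 [w2 [/(path_word_ebox_edown _ _ _ s0 hs IH) + [_ i1 ->] ->]]].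
  case=> j' [q [ks -> tq ->]]; have i0 : i = 0 by case: i i1.
  split=> //; exists ((a, (size s, k)) :: q).
    by apply/branch_NodeP; exists k, j', q.
  by rewrite i0 rev_cons map_rcons cats1.
case=> -> [_ /branch_NodeP[r [j' [q [rs -> -> tq]]]] ->].
exists r, (map down_letter (rev q)), [:: down_letter (a, (size s, r))].
split=> //; last by rewrite rev_cons map_rcons cats1.
by apply/path_word_ebox_edown => //; exists j', q.
Qed.

Lemma branch_labels (A : eqType) (T : ptree A) i p :
  branch T i p -> {subset map fst p <= labels T}.
Proof.
elim/ptree_mem_ind: T i p => [|a s IH] i p; first by case=> _ ->.
case/branch_NodeP => r [i' [p' [rs _ -> /(IH _ (mem_nth _ rs)) sub]]] v.
rewrite [map _ _]/= inE => /orP[/eqP->|/sub]; first exact: mem_head.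
exact: (labels_child a (mem_nth Leaf rs)).
Qed.

Lemma branch_lt (A : eqType) (T : ptree A) i p : branch T i p -> i < leaves T.
Proof.
elim/ptree_mem_ind: T i p => [|a s IH] i p; first by case=> ->.
case/branch_NodeP => r [i' [p' [rs -> _ /(IH _ (mem_nth _ rs)) lt]]].
by apply: flatten_indexP; rewrite (nth_map Leaf).
Qed.

(** Associativity of the numbering of a list of lists. *)
Lemma flatten_index_flatten (A : Type) (f : A -> nat) (ss : seq (seq A)) r q c :
  q <= size (nth [::] ss r) ->
  flatten_index (map f (flatten ss)) (flatten_index (shape ss) r q) c =
  flatten_index (map (fun s => sumn (map f s)) ss) r
    (flatten_index (map f (nth [::] ss r)) q c).
Proof.
rewrite /flatten_index; elim: ss r => [|s ss IH] [|r] /=.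
- by case: q.
- by case: q.
- move=> qs; rewrite !add0n map_cat takel_cat ?size_map //.
- move=> qs; rewrite -addnA map_cat take_cat size_map ltnNge leq_addr /=.
  by rewrite addKn sumn_cat -!addnA IH.
Qed.

Lemma nth_flatten_index (A : Type) (x0 : A) (ss : seq (seq A)) r q :
  q < size (nth [::] ss r) ->
  nth x0 (flatten ss) (flatten_index (shape ss) r q) = nth x0 (nth [::] ss r) q.
Proof.
move=> qs; have qs' : q < nth 0 (shape ss) r.
  case: (ltnP r (size ss)) qs => rs; first by rewrite (nth_map [::]).
  by rewrite nth_default.
by rewrite nth_flatten flatten_indexKl ?flatten_indexKr.
Qed.

(** A branch of U runs through the top part of U and then through the tree that
    hangs on the leaf reached there. *)
Lemma branch_hanging d U i p : branch U i p <-> exists r i' p1 p2,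
  [/\ r < size (hanging d U),
      i = flatten_index (map (@leaves nat) (hanging d U)) r i', p = p1 ++ p2 &
      branch (top_part d U) r p1 /\ branch (nth Leaf (hanging d U) r) i' p2].
Proof.
elim/ptree_mem_ind: U i p => [|a s IH] i p.
  split=> [[-> ->]|[[|r] [i' [p1 [p2 [//_ -> -> [[_ ->] [-> ->]]]]]]] //].
  by exists 0, 0, [::], [::].
rewrite [hanging _ _]/= [top_part _ _]/=; case: ifP => _; last first.
  split=> [h|[[|r] [i' [p1 [p2 [//_ -> -> [[_ ->] h]]]]]] //].
  by exists 0, i, [::], p.
set H := map (hanging d) s.
have nH r : r < size s -> nth [::] H r = hanging d (nth Leaf s r).
  by move=> rs; rewrite (nth_map Leaf).
have shH : shape H = map (@leaves nat) (map (top_part d) s).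
  by rewrite /shape -!map_comp; apply: eq_map => t /=; apply: size_hanging.
have lH : map (fun h => sumn (map (@leaves nat) h)) H = map (@leaves nat) s.
  by rewrite -map_comp; apply: eq_map => t /=; apply: leaves_hanging.
have idx r q c : r < size s -> q < size (hanging d (nth Leaf s r)) ->
    flatten_index (map (@leaves nat) (flatten H)) (flatten_index (shape H) r q) c =
    flatten_index (map (@leaves nat) s) r
      (flatten_index (map (@leaves nat) (hanging d (nth Leaf s r))) q c).
  by move=> rs qs; rewrite flatten_index_flatten nH ?lH // ltnW.
have nthH r q : r < size s -> q < size (hanging d (nth Leaf s r)) ->
    nth Leaf (flatten H) (flatten_index (shape H) r q) =
    nth Leaf (hanging d (nth Leaf s r)) q.
  by move=> rs qs; rewrite nth_flatten_index nH.
have topN r q p1 : r < size s -> branch (top_part d (nth Leaf s r)) q p1 ->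
    branch (Node a (map (top_part d) s)) (flatten_index (shape H) r q)
      ((a, (size s, r)) :: p1).
  move=> rs tp; apply/branch_NodeP; exists r, q, p1.
  by rewrite size_map shH; split=> //; rewrite (nth_map Leaf).
split.
  case/branch_NodeP => r [i0 [p0 [rs -> ->]]].
  case/(IH _ (mem_nth _ rs)) => q [i' [p1 [p2 [qs -> -> [tp1 tp2]]]]].
  exists (flatten_index (shape H) r q), i', ((a, (size s, r)) :: p1), p2.
  rewrite idx // nthH //; split=> //; last by split=> //; apply: topN.
  by rewrite size_flatten flatten_indexP // shH -map_comp (nth_map Leaf) //= -size_hanging.
case=> R [i' [p1 [p2 [_ -> -> [/branch_NodeP[r [q [p3 []]]]]]]]].
rewrite size_map => rs; rewrite -shH => -> -> ; rewrite (nth_map Leaf) // => tp3.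
have qs : q < size (hanging d (nth Leaf s r)) by rewrite size_hanging (branch_lt tp3).
rewrite nthH // idx // => tp2; apply/branch_NodeP.
exists r, (flatten_index (map (@leaves nat) (hanging d (nth Leaf s r))) q i'), (p3 ++ p2).
by split=> //; apply/(IH _ (mem_nth _ rs)); exists q, i', p3, p2.
Qed.

Lemma branch_corolla (A : Type) (a : A) n k q :
  branch (Node a (nseq n Leaf)) k q <-> k < n /\ q = [:: (a, (n, k))].
Proof.
have fi r c : r < n ->
    flatten_index (map (@leaves A) (nseq n Leaf)) r c = r + c.
  move=> rn; rewrite map_nseq (@flatten_index_const _ _ _ 1) ?muln1 //.
    by rewrite size_nseq ltnW.
  by move=> x /nseqP[].
split.
  case/branch_NodeP => r [i' [p']]; rewrite size_nseq => -[rn -> ->].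
  by rewrite nth_nseq rn fi // => -[-> ->]; rewrite addn0.
case=> kn ->; apply/branch_NodeP; exists k, 0, [::].
by rewrite size_nseq fi // addn0 nth_nseq kn.
Qed.

Lemma branch_ex (A : eqType) (T : ptree A) i :
  i < leaves T -> exists p, branch T i p.
Proof.
elim/ptree_mem_ind: T i => [|a s IH] i /=; first by case: i => // _; exists [::].
move=> lt; have rs := reshape_indexP lt; have cs := reshape_offsetP lt.
rewrite size_map in rs; rewrite (nth_map Leaf) // in cs.
have [p tp] := IH _ (mem_nth _ rs) _ cs.
exists ((a, (size s, reshape_index (map (@leaves A) s) i)) :: p); apply/branch_NodeP.
by do 3 eexists; split; eauto; rewrite reshape_indexK.
Qed.

Lemma branch_uniq (A : eqType) (T : ptree A) i p q :
  branch T i p -> branch T i q -> p = q.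
Proof.
elim/ptree_mem_ind: T i p q => [|a s IH] i p q; first by case=> _ -> [_ ->].
case/branch_NodeP => r [i' [p' [rs -> -> tp]]].
case/branch_NodeP => r2 [i2 [p2 [rs2 e -> tp2]]].
have lt : i' < nth 0 (map (@leaves A) s) r by rewrite (nth_map Leaf) // (branch_lt tp).
have lt2 : i2 < nth 0 (map (@leaves A) s) r2.
  by rewrite (nth_map Leaf) // (branch_lt tp2).
have er : r = r2 by rewrite -(flatten_indexKl lt) e flatten_indexKl.
have ei : i' = i2 by rewrite -(flatten_indexKr lt) e flatten_indexKr.
by subst r2 i2; rewrite (IH _ (mem_nth _ rs) _ _ _ tp tp2).
Qed.

Lemma desc_child (A : eqType) (r : rel A) a s t :
  desc r (Node a s) -> t \in s -> {in labels t, forall x, r a x} /\ desc r t.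
Proof. by move=> /= /allP h /h /andP[/allP h1 h2]. Qed.

Lemma desc_top d U : desc ltn U -> desc ltn (top_part d U).
Proof.
elim/ptree_mem_ind: U => // a s IH h /=; case: ifP => // _ /=.
rewrite all_map; apply/allP => t ts /=.
have [h1 h2] := desc_child h ts; rewrite IH // andbT.
by apply/allP => x /labels_top /h1.
Qed.

Lemma top_lt d U : {in labels (top_part d U), forall u, u < d}.
Proof.
elim/ptree_mem_ind: U => // a s IH u /=; case: ifP => // lt.
by case/labels_NodeP => [->|[_ /mapP[t ts ->] /(IH _ ts)]].
Qed.

Lemma desc_root_le (u : nat) s : desc ltn (Node u s) ->
  {in labels (Node u s), forall x, u <= x}.
Proof.
move=> h x /labels_NodeP[->//|[t ts xt]].
by have [h1 _] := desc_child h ts; apply/ltnW/h1.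
Qed.

Lemma desc_root_ge (d : nat) s : desc gtn (Node d s) ->
  {in labels (Node d s), forall x, x <= d}.
Proof.
move=> h x /labels_NodeP[->//|[t ts xt]].
by have [h1 _] := desc_child h ts; apply/ltnW/h1.
Qed.

Lemma desc_hanging d U H : desc ltn U -> H \in hanging d U ->
  desc ltn H /\ {in labels H, forall u, d <= u}.
Proof.
elim/ptree_mem_ind: U H => [|a s IH] H; first by rewrite inE => _ /eqP->.
move=> h; rewrite [hanging _ _]/=; case: ltnP => ad.
  case/flattenP => _ /mapP[t ts ->]; apply: IH => //.
  by case: (desc_child h ts).
rewrite inE => /eqP->; split=> // u /(desc_root_le h); exact: leq_trans.
Qed.

Lemma branch_all (A : eqType) (P : pred A) (T : ptree A) i p :
  branch T i p -> {in labels T, forall x, P x} -> all (fun x => P x.1) p.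
Proof.
move=> /branch_labels sub h; apply/allP => x xp; apply/h/sub.
exact: map_f.
Qed.

Lemma varpi_expr_renumber X : varpi_expr (renumber X) = varpi_expr X.
Proof.
case: X => U D; rewrite renumberE; apply: varpi_expr_cross.
by apply: rank_cross => v vs; rewrite mem_cat vs ?orbT.
Qed.

(** In the fraction, the branches of U and D at i and j are cut at the level d of
    the root of D.  The numerator contributes the part above d, which consists of
    the branch of the top part of U and the branch of D without its root; the
    denominator contributes the branch of a hanging tree and the root of D.  The
    word is the concatenation by [interleave_cat].  The other two cases are cuts
    of the same kind. *)
Lemma path_word_varpi U D j i w :
  planar U -> planar D -> desc ltn U -> desc gtn D ->
  path_word (varpi_expr (U, D)) j i w <->
  exists p q, [/\ branch U i p, branch D j q & w = interleave p (rev q)].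
Proof.
have [N] := ubnP (nverts U + nverts D).
elim: N U D j i w => // N IH [|u Us] [|d Ds] j i w hN pU pD dU dD.
- rewrite varpi_expr_Leafl; split=> [[-> -> ->]|[p [q [[-> ->] [-> ->] ->]]]] //.
  by exists [::], [::].
- rewrite varpi_expr_Leafl path_word_edown //; split.
    by case=> -> [q tq ->]; exists [::], q; rewrite interleavel0.
  by case=> p [q [[-> ->] tq ->]]; split=> //; exists q; rewrite ?interleavel0.
- rewrite varpi_expr_Leafr path_word_eup //; split.
    by case=> -> [p tp ->]; exists p, [::]; rewrite interleaver0.
  by case=> p [q [tp [-> ->] ->]]; split=> //; exists p; rewrite ?interleaver0.
have /andP[U1 hUs] : (1 < size Us) && all (@planar nat) Us := pU.
have /andP[D1 hDs] : (1 < size Ds) && all (@planar nat) Ds := pD.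
have U0 : 0 < size Us by apply: ltnW.
have D0 : 0 < size Ds by apply: ltnW.
have geU := desc_root_le dU; have leD := desc_root_ge dD.
rewrite varpi_exprE; case: ltngtP => ud.
- have split_ p q : branch (Node u Us) i p -> branch (Node d Ds) j q ->
      interleave p (rev q) = map down_letter (rev q) ++ map up_letter p.
    move=> tp tq; have := @interleave_cat u [::] p (rev q) [::] isT.
    rewrite cats0 interleavel0 interleaver0; apply=> //.
      rewrite all_rev; apply: (branch_all (P := ltn^~ u) tq) => x /leD le.
      exact: leq_ltn_trans le ud.
    exact: (branch_all (P := leq u) tp).
  split.
    case=> k [w1 [w2 [/(path_word_edown pD)[k0 [q tq ->]] /(path_word_eup pU)[_ [p tp ->]] ->]]].
    by exists p, q; rewrite split_.
  case=> p [q [tp tq ->]]; rewrite split_ //.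
  exists 0, (map down_letter (rev q)), (map up_letter p); split=> //.
    by apply/path_word_edown => //; split=> //; exists q.
  by apply/path_word_eup => //; split=> //; exists p.
- rewrite !(eq_map (fun t => varpi_expr_renumber (_, t))).
  rewrite !(eq_map (fun t => varpi_expr_renumber (t, _))).
  set U := Node u Us; set D := Node d Ds; set c := Node d (nseq (size Ds) Leaf).
  set H := hanging d U; set T := top_part d U.
  have pT : planar T by apply: planar_top.
  have sH : size H = leaves T by apply: size_hanging.
  have H0 : 0 < size H by rewrite sH leaves_gt0.
  have pH := allP (planar_hanging d pU).
  have pc : planar c by rewrite planar_corolla.
  have bB t : t \in Ds -> has_biarity (leaves t) (size H) (varpi_expr (T, t)).
    by move=> tD; apply: varpi_biarity; rewrite /trees_ok pT (allP hDs) // sH !eqxx.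
  have bA t : t \in H -> has_biarity (size Ds) (leaves t) (varpi_expr (t, c)).
    move=> tH; apply: varpi_biarity.
    by rewrite /trees_ok pH // pc [leaves c]leaves_corolla !eqxx.
  have oB : map outs [seq varpi_expr (T, t) | t <- Ds] = map (@leaves nat) Ds.
    by rewrite -map_comp; apply/eq_in_map => t /bB /and3P[_ /eqP].
  have iA : map inps [seq varpi_expr (t, c) | t <- H] = map (@leaves nat) H.
    by rewrite -map_comp; apply/eq_in_map => t /bA /and3P[_ _ /eqP].
  have IHB t k i0 v : t < size Ds -> path_word (varpi_expr (T, nth Leaf Ds t)) k i0 v <->
      exists p q, [/\ branch T i0 p, branch (nth Leaf Ds t) k q & v = interleave p (rev q)].
    move=> tD; have tD' := mem_nth Leaf tD; apply: IH.
    + rewrite -ltnS; apply: leq_trans hN; rewrite ltnS -addnS leq_add ?nverts_top //.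
      exact: nverts_mem.
    + by [].
    + exact: (allP hDs).
    + exact: desc_top.
    + by case: (desc_child dD tD').
  have IHA s k i0 v : s < size H -> path_word (varpi_expr (nth Leaf H s, c)) k i0 v <->
      exists p q, [/\ branch (nth Leaf H s) i0 p, branch c k q & v = interleave p (rev q)].
    move=> sH'; have sH2 := mem_nth Leaf sH'; apply: IH.
    + rewrite -ltnS; apply: leq_trans hN; rewrite ltnS nverts_corolla -addSn leq_add //.
      exact: (allP (nverts_hanging_lt Us ud)).
    + exact: pH.
    + by [].
    + by case: (desc_hanging dU sH2).
    + by rewrite /= all_nseq /= orbT.
  have split_ r t p1 p2 q1 i' j' : r < size H -> t < size Ds ->
      branch T r p1 -> branch (nth Leaf H r) i' p2 -> branch (nth Leaf Ds t) j' q1 ->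
      interleave (p1 ++ p2) (rev ((d, (size Ds, t)) :: q1)) =
      interleave p1 (rev q1) ++ interleave p2 (rev [:: (d, (size Ds, t))]).
    move=> rH tD tp1 tp2 tq; rewrite rev_cons -cats1; apply: (@interleave_cat d).
    + by apply: (branch_all (P := ltn^~ d) tp1); apply: top_lt.
    + rewrite all_rev; apply: (branch_all (P := ltn^~ d) tq) => x.
      by case: (desc_child dD (mem_nth Leaf tD)) => h _; apply: h.
    + by apply: (branch_all (P := leq d) tp2); case: (desc_hanging dU (mem_nth Leaf rH)).
    + by rewrite /= leqnn.
  have tc k q := branch_corolla d (size Ds) k q.
  rewrite path_word_fraction ?size_map //; first last.
  + by move=> _ /mapP[t /bA /and3P[wa /eqP oa _] ->].
  + by move=> _ /mapP[t /bB /and3P[wa _ /eqP oa] ->].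
  rewrite oB iA; split.
    case=> t [s [j' [i' [w1 [w2 [[tD sH'] -> -> [+ + ->]]]]]]].
    rewrite !(nth_map Leaf) // => /IHB -/(_ tD)[p1 [q1 [tp1 tq1 ->]]].
    case/IHA => // p2 [_ [tp2 /tc[_ ->] ->]].
    exists (p1 ++ p2), ((d, (size Ds, t)) :: q1); split.
    + by apply/(branch_hanging d); exists s, i', p1, p2.
    + by apply/branch_NodeP; exists t, j', q1.
    + by rewrite (split_ s t _ _ _ i' j').
  case=> p0 [q0 [/(branch_hanging d)[s [i' [p1 [p2 [sH' -> -> [tp1 tp2]]]]]]]].
  case/branch_NodeP => t [j' [q1 [tD -> -> tq1]]] ->.
  exists t, s, j', i', (interleave p1 (rev q1)), (interleave p2 (rev [:: (d, (size Ds, t))])).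
  split=> //; rewrite !(nth_map Leaf) //; split.
  + by apply/IHB => //; exists p1, q1.
  + by apply/IHA => //; exists p2, [:: (d, (size Ds, t))]; split=> //; apply/tc.
  + exact: (split_ s t _ _ _ i' j').
- have IHU : {in Us, forall t, eup_spec t} by move=> t /(allP hUs); apply: path_word_eup.
  have IHD : {in Ds, forall t, edown_spec t} by move=> t /(allP hDs); apply: path_word_edown.
  have split_ s t p q i' j' : s < size Us -> t < size Ds ->
      branch (nth Leaf Us s) i' p -> branch (nth Leaf Ds t) j' q ->
      interleave ((u, (size Us, s)) :: p) (rev ((d, (size Ds, t)) :: q)) =
      map down_letter (rev q) ++ ((size Us, s), (size Ds, t)) :: map up_letter p.
    move=> sU tD tp tq; rewrite rev_cons -cats1 -interleavel0.
    rewrite -[X in interleave X]cat0s (@interleave_cat d) //=; last by rewrite leqnn.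
    + by rewrite ud ltnn interleaver0.
    + rewrite all_rev; apply: (branch_all (P := ltn^~ d) tq) => x.
      by case: (desc_child dD (mem_nth Leaf tD)) => h _; apply: h.
    + rewrite -ud leqnn; apply: (branch_all (P := leq d) tp) => x.
      by case: (desc_child dU (mem_nth Leaf sU)) => h _ xs; rewrite ud; apply/ltnW/h.
  split.
    case=> k [w1 [w2 [/path_word_ebox_edown -/(_ D0 hDs IHD)[j' [q [kD -> tq ->]]]]]].
    case=> l [w3 [w4 [[_ lU ->] /path_word_ebox_eup -/(_ U0 hUs IHU)]]].
    case=> i' [p [_ -> tp ->]] -> ->.
    exists ((u, (size Us, l)) :: p), ((d, (size Ds, k)) :: q); split.
    + by apply/branch_NodeP; exists l, i', p.
    + by apply/branch_NodeP; exists k, j', q.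
    + by rewrite (split_ l k _ _ i' j').
  case=> p0 [q0 [/branch_NodeP[l [i' [p [lU -> -> tp]]]]]].
  case/branch_NodeP => k [j' [q [kD -> -> tq]]] ->.
  exists k, (map down_letter (rev q)), (((size Us, l), (size Ds, k)) :: map up_letter p); split.
  + by apply/path_word_ebox_edown => //; exists j', q.
  + exists l, [:: ((size Us, l), (size Ds, k))], (map up_letter p); split=> //.
    by apply/path_word_ebox_eup => //; exists i', p.
  + exact: (split_ l k _ _ i' j').
Qed.

(** * Recovering the trees and the comparisons from the words *)

Lemma planar_leaves_gt0 (A : eqType) (T : ptree A) : planar T -> 0 < leaves T.
Proof.
elim/ptree_mem_ind: T => // a [|t s] IH //= /andP[_ /andP[pt _]].
by rewrite ltn_addr // IH ?mem_head.
Qed.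

Lemma branch_arity (A : eqType) (T : ptree A) i p :
  planar T -> branch T i p -> all (fun x => 1 < x.2.1) p.
Proof.
elim/ptree_mem_ind: T i p => [|a s IH] i p; first by move=> _ [_ ->].
move=> /= /andP[s1 /allP ps] /branch_NodeP[r [i' [p' [rs _ -> tp]]]] /=.
by rewrite s1 (IH _ (mem_nth _ rs) _ _ (ps _ (mem_nth _ rs)) tp).
Qed.

Lemma branch_cover (A : eqType) (T : ptree A) v : planar T -> v \in labels T ->
  exists i p, branch T i p /\ v \in map fst p.
Proof.
elim/ptree_mem_ind: T => // a s IH pT; case/labels_NodeP => [->|[t ts vt]].
  have [p tp] := branch_ex (planar_leaves_gt0 pT); exists 0, p; split=> //.
  by case/branch_NodeP: tp => r [i' [p' [_ _ -> _]]]; rewrite mem_head.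
have /= /andP[_ /allP ps] := pT.
have [i [p [tp vp]]] := IH t ts (ps t ts) vt.
case/(nthP Leaf): ts => r rs et.
exists (flatten_index (map (@leaves A) s) r i), ((a, (size s, r)) :: p).
split; last by rewrite /= inE vp orbT.
by apply/branch_NodeP; exists r, i, p; rewrite et.
Qed.

Definition relabel (A B : Type) (f : A -> B) (p : seq (A * (nat * nat))) :
  seq (B * (nat * nat)) := [seq (f x.1, x.2) | x <- p].

Lemma branch_tmap (A B : eqType) (f : A -> B) T i p :
  branch T i p -> branch (tmap f T) i (relabel f p).
Proof.
elim/ptree_mem_ind: T i p => [|a s IH] i p; first by case=> -> ->.
case/branch_NodeP => r [i' [p' [rs -> -> tp]]]; apply/branch_NodeP.
exists r, i', (relabel f p'); rewrite size_map; split=> //.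
  by rewrite -map_comp; congr flatten_index; apply: eq_map => t; rewrite /= leaves_tmap.
by rewrite (nth_map Leaf) //; apply: IH => //; apply: mem_nth.
Qed.

Lemma branch_pairwise (A : eqType) (r : rel A) T i p :
  desc r T -> branch T i p -> pairwise r (map fst p).
Proof.
elim/ptree_mem_ind: T i p => [|a s IH] i p; first by move=> _ [_ ->].
move=> dT /branch_NodeP[k [i' [p' [ks _ -> tp]]]] /=.
have [h1 h2] := desc_child dT (mem_nth Leaf ks).
rewrite (IH _ (mem_nth _ ks) _ _ h2 tp) andbT; apply/allP => x.
by move/(branch_labels tp)/h1.
Qed.

(** Arities of vertices are at least 2, and 1 marks the letters that do not involve U. *)
Lemma interleave_up p q : all (fun x => 1 < x.2.1) p ->
  [seq l.1 | l <- interleave p q & 1 < l.1.1] = map snd p.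
Proof.
have dn0 q' : [seq l.1 | l <- map down_letter q' & 1 < l.1.1] = [::] by elim: q'.
elim: p q => [|x p IHp] q; first by rewrite interleavel0 dn0.
move=> hp; have /andP[x1 p1] := hp.
elim: q => [|y q IHq].
  by rewrite interleaver0 /= x1 /= -(IHp [::]) // interleaver0.
rewrite interleave_cons; case: ifP => _; first by rewrite /= x1 /= IHp.
by case: ifP => _; rewrite /= ?IHq // x1 /= IHp.
Qed.

Lemma interleave_down p q : all (fun x => 1 < x.2.1) q ->
  [seq l.2 | l <- interleave p q & 1 < l.2.1] = map snd q.
Proof.
have up0 p' : [seq l.2 | l <- map up_letter p' & 1 < l.2.1] = [::] by elim: p'.
have dn q' : all (fun x => 1 < x.2.1) q' ->
    [seq l.2 | l <- map down_letter q' & 1 < l.2.1] = map snd q'.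
  by elim: q' => //= y q' IH /andP[y1 /IH e]; rewrite y1 /= e.
elim: p q => [|x p IHp] q; first by rewrite interleavel0 => /dn.
elim: q => [|y q IHq]; first by rewrite interleaver0 up0.
move=> hq; have /andP[y1 q1] := hq.
rewrite interleave_cons; case: ifP => _; first by rewrite /= IHp.
by case: ifP => _; rewrite /= y1 /= ?IHq // IHp.
Qed.

(** The first letter of the word shows which of the two first vertices is higher,
    or that they are on the same level; since both lists are sorted, this decides
    all comparisons with the vertex that is removed. *)
Lemma interleave_cross (A : eqType) (f g : A -> nat) p q :
  all (fun x => 1 < x.2.1) p -> all (fun x => 1 < x.2.1) q ->
  pairwise ltn (map (f \o fst) p) -> pairwise ltn (map (f \o fst) q) ->
  pairwise ltn (map (g \o fst) p) -> pairwise ltn (map (g \o fst) q) ->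
  interleave (relabel f p) (relabel f q) = interleave (relabel g p) (relabel g q) ->
  cross_eq (f \o fst) (g \o fst) p q.
Proof.
have above (h : A -> nat) (x y : A * (nat * nat)) s k : k <= h x.1 ->
    pairwise ltn (map (h \o fst) (x :: s)) -> y \in s -> k < h y.1.
  move=> kx /= /andP[/allP hs _] ys; apply: leq_ltn_trans kx _.
  by apply: hs; apply: (map_f (h \o fst)).
have aboveE (h : A -> nat) (x y : A * (nat * nat)) s k : k < h x.1 ->
    pairwise ltn (map (h \o fst) (x :: s)) -> y \in x :: s -> k < h y.1.
  by move=> kx hs; rewrite inE => /orP[/eqP->//|]; apply: above (ltnW kx) hs.
have gtF (k l : nat) : k < l -> (l < k) = false by move=> lt; rewrite ltnNge ltnW.
elim: p q => [|x p IHp] // q ap; have /andP[x1 p1] := ap.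
elim: q => [|y q IHq] // aq fp fq gp gq; have /andP[y1 q1] := aq.
have fp' : pairwise ltn (map (f \o fst) p) by have /andP[] := fp.
have fq' : pairwise ltn (map (f \o fst) q) by have /andP[] := fq.
have gp' : pairwise ltn (map (g \o fst) p) by have /andP[] := gp.
have gq' : pairwise ltn (map (g \o fst) q) by have /andP[] := gq.
rewrite [relabel f (x :: p)]/= [relabel f (y :: q)]/=.
rewrite [relabel g (x :: p)]/= [relabel g (y :: q)]/= !interleave_cons.
rewrite -![(_, _) :: _]/(relabel _ (_ :: _)) !(fun_if, if_arg) /=.
have nx : x.2 <> (1, 0) by move=> e; rewrite e in x1.
have ny : y.2 <> (1, 0) by move=> e; rewrite e in y1.
case: (ltngtP (f x.1) (f y.1)) => cf; case: (ltngtP (g x.1) (g y.1)) => cg;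
  case=> //; try by [move/esym/nx|move/esym/ny|move/nx|move/ny].
- move/(IHp (y :: q) p1 aq fp' fq gp' gq) => h u v.
  rewrite inE => /orP[/eqP-> vq /=|up vq]; last exact: h.
  have lf := aboveE f _ _ _ _ cf fq vq; have lg := aboveE g _ _ _ _ cg gq vq.
  by rewrite lf lg (gtF _ _ lf) (gtF _ _ lg).
- move/(IHq q1 fp fq' gp gq') => h u v up.
  rewrite inE => /orP[/eqP-> /=|vq]; last exact: h.
  have lf := aboveE f _ _ _ _ cf fp up; have lg := aboveE g _ _ _ _ cg gp up.
  by rewrite lf lg (gtF _ _ lf) (gtF _ _ lg).
- move=> /(IHp q p1 q1 fp' fq' gp' gq') h u v.
  rewrite !inE => /orP[/eqP->|up] /orP[/eqP->|vq] /=.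
  + by rewrite cf cg !ltnn.
  + have lf := above f y v q _ (leqnn _) fq vq; have lg := above g y v q _ (leqnn _) gq vq.
    by rewrite cf cg lf lg (gtF _ _ lf) (gtF _ _ lg).
  + have lf := above f x u p _ (leqnn _) fp up; have lg := above g x u p _ (leqnn _) gp up.
    by rewrite -cf -cg lf lg (gtF _ _ lf) (gtF _ _ lg).
  + exact: h.
Qed.

Lemma reshape_index_cons x sh i : reshape_index (x :: sh) i =
  if i < x then 0 else (reshape_index sh (i - x)).+1.
Proof.
by rewrite /reshape_index /= subn_eq0; case: ltnP => // le; rewrite subSn.
Qed.

(** The block sizes can be read off from the block in which each position lies. *)
Lemma reshape_index_inj sh sh' : size sh = size sh' -> sumn sh = sumn sh' ->
  (forall i, i < sumn sh -> reshape_index sh i = reshape_index sh' i) -> sh = sh'.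
Proof.
elim: sh sh' => [|x sh IH] [|y sh'] //= [es] en h.
have exy : x = y.
  case: (ltngtP x y) => // lt.
    have := h x; rewrite !reshape_index_cons ltnn lt; have -> : x < x + sumn sh by lia.
    by move=> /(_ isT).
  have := h y; rewrite !reshape_index_cons ltnn lt; have -> : y < x + sumn sh by lia.
  by move=> /(_ isT).
subst y; congr cons; apply: IH => //; first by lia.
move=> i lt; have := h (x + i); rewrite ltn_add2l !reshape_index_cons (ltnNge (x + i)) leq_addr.
by rewrite addKn => /(_ lt)[].
Qed.

(** Two trees of the same shape are stated to be the two projections of one tree
    labelled by pairs, which makes corresponding vertices available. *)
Lemma branch_shape (T1 T2 : ptree nat) : planar T1 -> planar T2 ->
  leaves T1 = leaves T2 ->
  (forall i p1 p2, branch T1 i p1 -> branch T2 i p2 -> map snd p1 = map snd p2) ->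
  exists Z : ptree (nat * nat), tmap fst Z = T1 /\ tmap snd Z = T2.
Proof.
elim/ptree_mem_ind: T1 T2 => [|a s IH] [|b t] pT1 pT2 eL h.
- by exists Leaf.
- have [p tp] := branch_ex (planar_leaves_gt0 pT2).
  have := h 0 [::] p (conj erefl erefl) tp.
  by case/branch_NodeP: tp => r [i' [p' [_ _ -> _]]].
- have [p tp] := branch_ex (planar_leaves_gt0 pT1).
  have := h 0 p [::] tp (conj erefl erefl).
  by case/branch_NodeP: tp => r [i' [p' [_ _ -> _]]].
have node i : i < leaves (Node a s) -> size s = size t /\
    reshape_index (map (@leaves nat) s) i = reshape_index (map (@leaves nat) t) i.
  move=> lt; have [p1 tp1] := branch_ex lt.
  have [p2 tp2] : exists p, branch (Node b t) i p by apply: branch_ex; rewrite -eL.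
  have := h i p1 p2 tp1 tp2.
  case/branch_NodeP: tp1 => r1 [i1 [q1 [rs1 e1 -> tq1]]].
  case/branch_NodeP: tp2 => r2 [i2 [q2 [rs2 e2 -> tq2]]] /= [-> er _].
  split=> //; rewrite {1}e1 e2 !flatten_indexKl //.
    by rewrite (nth_map Leaf) // (branch_lt tq1).
  by rewrite (nth_map Leaf) // (branch_lt tq2).
have [est _] := node 0 (planar_leaves_gt0 pT1).
have esh : map (@leaves nat) s = map (@leaves nat) t.
  apply: reshape_index_inj; rewrite ?size_map // => i lt.
  by case: (node i lt).
have child r : exists Z : ptree (nat * nat), r < size s ->
    tmap fst Z = nth Leaf s r /\ tmap snd Z = nth Leaf t r.
  case: (ltnP r (size s)) => rs; last by exists Leaf.
  have rt : r < size t by rewrite -est.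
  have [/= /andP[_ /allP ps] /= /andP[_ /allP pt]] := (pT1, pT2).
  have [|||||Z eZ] := IH (nth Leaf s r) _ (nth Leaf t r); last by exists Z.
  - exact: mem_nth.
  - exact/ps/mem_nth.
  - exact/pt/mem_nth.
  - by rewrite -!(nth_map _ 0 (@leaves nat)) // esh.
  move=> i p1 p2 tp1 tp2.
  suff : map snd ((a, (size s, r)) :: p1) = map snd ((b, (size t, r)) :: p2) by case.
  apply: (h (flatten_index (map (@leaves nat) s) r i)).
    by apply/branch_NodeP; exists r, i, p1.
  by apply/branch_NodeP; exists r, i, p2; rewrite -esh.
have [F hF] := choice child.
exists (Node (a, b) (mkseq F (size s))); rewrite /= /mkseq -!map_comp.
split; congr Node.
  apply: (@eq_from_nth _ Leaf) => [|r]; rewrite size_map size_iota // => rs.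
  by rewrite (nth_map 0) ?size_iota // nth_iota //=; case: (hF r rs).
apply: (@eq_from_nth _ Leaf) => [|r]; rewrite size_map size_iota // => rs.
by rewrite (nth_map 0) ?size_iota // nth_iota //=; case: (hF r rs).
Qed.

(** The words of varpi give trees ZU and ZD of pairs, with the levels of X1 and X2
    as the components, and the same comparisons for both components.  As the
    projections are zone functions with these comparisons, they agree. *)
Lemma peq_varpi_proj n m X1 X2 : is_level n m X1 -> is_level n m X2 ->
  peq (varpi_expr X1) (varpi_expr X2) -> proj X1 = proj X2.
Proof.
case: X1 X2 => U1 D1 [U2 D2] l1 l2 eX.
have z1 := proj_zone l1; have z2 := proj_zone l2.
case/and4P: l1 => /and4P /= [pU1 pD1 /eqP mU1 /eqP nD1] o1 dU1 dD1.
case/and4P: l2 => /and4P /= [pU2 pD2 /eqP mU2 /eqP nD2] o2 dU2 dD2.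
have words i j p1 q1 p2 q2 : branch U1 i p1 -> branch D1 j q1 ->
    branch U2 i p2 -> branch D2 j q2 ->
    interleave p1 (rev q1) = interleave p2 (rev q2).
  move=> tp1 tq1 tp2 tq2.
  have : path_word (varpi_expr (U1, D1)) j i (interleave p1 (rev q1)).
    by apply/path_word_varpi => //; exists p1, q1.
  case/(path_word_peq eX)/(path_word_varpi _ _ _ pU2 pD2 dU2 dD2) => p [q [tp tq ->]].
  by rewrite (branch_uniq tp tp2) (branch_uniq tq tq2).
have [ZU [eU1 eU2]] : exists Z, tmap fst Z = U1 /\ tmap snd Z = U2.
  apply: branch_shape; rewrite ?mU1 // => i p1 p2 tp1 tp2.
  have [q1 tq1] := branch_ex (planar_leaves_gt0 pD1).
  have [q2 tq2] := branch_ex (planar_leaves_gt0 pD2).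
  rewrite -(interleave_up (rev q1) (branch_arity pU1 tp1)) (words _ _ _ _ _ _ tp1 tq1 tp2 tq2).
  by rewrite interleave_up ?(branch_arity pU2 tp2).
have [ZD [eD1 eD2]] : exists Z, tmap fst Z = D1 /\ tmap snd Z = D2.
  apply: branch_shape; rewrite ?nD1 // => j q1 q2 tq1 tq2; apply: (can_inj revK).
  have [p1 tp1] := branch_ex (planar_leaves_gt0 pU1).
  have [p2 tp2] := branch_ex (planar_leaves_gt0 pU2).
  rewrite -!map_rev -(interleave_down p1); last by rewrite all_rev (branch_arity pD1 tq1).
  rewrite (words _ _ _ _ _ _ tp1 tq1 tp2 tq2).
  by rewrite interleave_down // all_rev (branch_arity pD2 tq2).
have pZU : planar ZU by rewrite -(planar_tmap fst) eU1.
have pZD : planar ZD by rewrite -(planar_tmap fst) eD1.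
have cZ : cross_eq fst snd (labels ZU) (labels ZD).
  move=> u d /(branch_cover pZU)[i [p [tp /mapP[x xp ->]]]].
  case/(branch_cover pZD) => j [q [tq /mapP[y yq ->]]].
  have sU h T : desc ltn T -> tmap h ZU = T -> pairwise ltn (map (h \o fst) p).
    move=> dT eT; have := branch_tmap h tp; rewrite eT => /(branch_pairwise dT).
    by rewrite -map_comp.
  have sD h T : desc gtn T -> tmap h ZD = T -> pairwise ltn (map (h \o fst) (rev q)).
    move=> dT eT; have := branch_tmap h tq; rewrite eT => /(branch_pairwise dT).
    rewrite -map_comp map_rev -!sorted_pairwise ?rev_sorted //; first exact: ltn_trans.
    by move=> k l i' lk kl; apply: ltn_trans kl lk.
  have yr : y \in rev q by rewrite mem_rev.
  apply: (interleave_cross (f := fst) (g := snd)) xp yr.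
  - exact: branch_arity tp.
  - by rewrite all_rev (branch_arity pZD tq).
  - exact: sU eU1.
  - exact: sD eD1.
  - exact: sU eU2.
  - exact: sD eD2.
  rewrite /relabel !map_rev; apply: words.
  - by rewrite -eU1; apply: branch_tmap tp.
  - by rewrite -eD1; apply: branch_tmap tq.
  - by rewrite -eU2; apply: branch_tmap tp.
  - by rewrite -eD2; apply: branch_tmap tq.
pose f (x : nat * nat) := Defs.merge (U1, D1) x.1.
pose g (x : nat * nat) := Defs.merge (U2, D2) x.2.
have e1 : proj (U1, D1) = (tmap f ZU, tmap f ZD).
  by rewrite /proj /= -{2}eU1 -{3}eD1 !tmap_comp.
have e2 : proj (U2, D2) = (tmap g ZU, tmap g ZD).
  by rewrite /proj /= -{2}eU2 -{3}eD2 !tmap_comp.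
rewrite e1 e2; apply: (@zone_unique _ n m); rewrite -?e1 -?e2 // => u d uZ dZ.
have u1 : u.1 \in labels (U1, D1).1 by rewrite /= -eU1 labels_tmap map_f.
have u2 : u.2 \in labels (U2, D2).1 by rewrite /= -eU2 labels_tmap map_f.
have d1 : d.1 \in labels (U1, D1).2 by rewrite /= -eD1 labels_tmap map_f.
have d2 : d.2 \in labels (U2, D2).2 by rewrite /= -eD2 labels_tmap map_f.
by rewrite /f /g !(merge_cross o1 u1 d1) !(merge_cross o2 u2 d2) !(cZ _ _ uZ dZ).
Qed.

(** * The classification *)

Definition corolla (k : nat) : ptree nat :=
  if k == 1 then Leaf else Node 1 (nseq k Leaf).

(** It makes the set of zone functions nonempty, so that a map defined on the image
    of varpi can be extended to the whole set of operations. *)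
Lemma corolla_level n m : 0 < n -> 0 < m -> is_level n m (corolla m, corolla n).
Proof.
have ok k : 0 < k -> planar (corolla k) && (leaves (corolla k) == k).
  rewrite /corolla; case: eqP => [->//|/eqP k1 k0].
  by rewrite planar_corolla leaves_corolla eqxx andbT ltn_neqAle eq_sym k1.
have lc k : labels (corolla k) = if k == 1 then [::] else [:: 1].
  by rewrite /corolla; case: eqP => // _; rewrite labels_corolla.
have dc k r : desc r (corolla k).
  by rewrite /corolla; case: eqP => //= _; rewrite all_nseq /= orbT.
move=> /ok/andP[pn ln] /ok/andP[pm lm]; apply/and4P.
split; [exact/and4P | | exact: dc | exact: dc].
rewrite /onto_interval /height /plabels /= !lc.
by case: (m == 1); case: (n == 1).
Qed.

Local Open Scope classical_set_scope.

Theorem theoremC (m n : nat) (hm : (1 <= m)%N) (hn : (1 <= n)%N) :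
  (forall X' X'' : lT n m, varpi X' = varpi X'' <-> zproj X' = zproj X'') /\
  (exists f : FXi n m -> zT n m,
      set_bij (range (@varpi n m)) [set: zT n m] f /\
      (forall X : lT n m, f (varpi X) = zproj X)).
Proof.
have key (X' X'' : lT n m) : varpi X' = varpi X'' <-> zproj X' = zproj X''.
  rewrite clsP; split=> [e|/(congr1 sval) /= e].
    by apply: val_inj => /=; exact: peq_varpi_proj (svalP X') (svalP X'') e.
  have oX (X : lT n m) : onto_interval (sval X) by case/and4P: (svalP X).
  rewrite -(varpi_expr_proj (oX X')) e (varpi_expr_proj (oX X'')).
  by apply: peq_refl; have /and3P[] := varpi_biarity (lT_trees_ok X'').
split=> //.
pose X0 : lT n m := exist (fun X => is_level n m X) _ (corolla_level hn hm).
pose f (x : FXi n m) : zT n m :=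
  if pselect (exists X, varpi X = x) is left h then zproj (projT1 (cid h))
  else zproj X0.
have fE X : f (varpi X) = zproj X.
  rewrite /f; case: pselect => [h|[]]; last by exists X.
  by apply/key; case: (cid h).
exists f; split=> //; split.
- by [].
- move=> _ _ /set_mem[X _ <-] /set_mem[Y _ <-]; rewrite !fE => /key.
  by [].
- move=> Z _; have [X lX eX] := proj_onto (svalP Z).
  pose X' : lT n m := exist (fun X => is_level n m X) X lX.
  exists (varpi X'); first by exists X'.
  by rewrite fE; apply: val_inj.
Qed.
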